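(* Let $\phi:\mathcal U_M\to B(H)$ be unital and completely positive. For a word $w=a_1\cdots a_n$ of length $n\ge2$ in the labels $\mathcal A$, put $T_w=T_{a_1}\cdots T_{a_n}$. Then $$\|R[\phi(w)-T_w]R\|_1\le\sum_{1\le i<j\le n}e_R\big(a_i^*;(T_{a_1}\cdots T_{a_{i-1}})^*\big)\Big(\prod_{i<k<j}\|a_k\|_{\mathcal U_M}\Big)e_R\big(a_j;T_{a_{j+1}}\cdots T_{a_n}\big).$$ If each compressed generator $T_a$, $a\in\mathcal A$, belongs to $\mathfrak M_R$, then the two contextual factors are at most $$e_R(a_i^*;I)\prod_{k<i}\vartheta_R(T_{a_k}^* )\qquad\text{and}\qquad e_R(a_j;I)\prod_{k>j}\vartheta_R(T_{a_k}),$$ respectively. In particular, if $K\ge\max(1,M)$ and $\Lambda_R(T_a)\le K$ for every label $a\in\mathcal A$, then $$\|R[\phi(w)-T_w]R\|_1\le\binom n2K^{n-2}\delta_R(\phi).$$ In this last case one also has the full trace-class estimate $$\|\mathcal Q(\phi)-\mathcal Q(\pi_T)\|_1\le\big(e^K+2e^{2K}\big)\delta_R(\phi),$$ where $\pi_T$ is the representation of $\mathcal U_M$ defined by the norm-bounded tuple $T=(\phi(x_1),\dots,\phi(x_d))$.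
   Context: $H$ is a separable complex Hilbert space and $R$ a positive injective Hilbert--Schmidt operator on $H$ (normalization not needed). $\mathcal U_M$, $M>0$, is the universal unital $C^*$-algebra generated by $d$ elements $x_1,\dots,x_d$ of norm at most $M$; $\mathcal A=\{x_1,\dots,x_d,x_1^*,\dots,x_d^*\}$ are its generator and adjoint labels, and $T_a=\phi(a)$ for $a\in\mathcal A$. Empty products are identities. For $a\in\mathcal A$ and a bounded operator $C$ on $H$, $$S_\phi(a)=\phi(a^*a)-T_a^*T_a\ge0,\qquad e_R(a;C)=\operatorname{Tr}\big(RC^*S_\phi(a)CR\big)^{1/2},\qquad\delta_R(\phi)=\sum_{a\in\mathcal A}e_R(a;I)^2.$$ For $B\in B(H)$, $\vartheta_R(B)=\inf\{c\ge0:BR^2B^*\le c^2R^2\}$ (infinite if no such $c$), $\mathfrak M_R=\{B\in B(H):\vartheta_R(B),\vartheta_R(B^* )<\infty\}$, $\Lambda_R(B)=\max(\|B\|,\vartheta_R(B),\vartheta_R(B^* ))$. The word encoding: choose homogeneous $*$-polynomials $(p_i)_{i\ge0}$ in the generators spanning all words, $p_0=1$; for $i\ge1$ let $n_i\ge1$ be the degree of $p_i$, $a_i$ the sum of absolute values of its word coefficients, $c_0=1$, $c_i=2^{-i}/(n_i!\max(1,a_i))$. For a unital completely positive map $\psi:\mathcal U_M\to B(H)$, $\mathcal Q(\psi)$ is the block operator on $\ell^2(\mathbb N_0)\otimes H$ with blocks $\mathcal Q(\psi)_{ij}=c_ic_jR\psi(p_i^*p_j)R$. *)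

(* Defs.v *)
From HB Require Import structures.
From mathcomp Require Import all_boot all_order all_algebra sesquilinear.
From mathcomp Require Import all_classical all_reals all_analysis.
From mathcomp Require Import complex.

Set Implicit Arguments.
Unset Strict Implicit.
Unset Printing Implicit Defensive.

Import Order.TTheory GRing.Theory Num.Theory.
Import numFieldNormedType.Exports.

Local Open Scope classical_set_scope.
Local Open Scope complex_scope.
Local Open Scope ring_scope.

(** * Hilbert spaces *)

(* The inner product is linear in its first argument. *)
HB.mixin Record isHilbert (R : realType) H of CompleteNormedModule R[i] H := {
  hdot : {dot H for @Num.conj R[i]} ;
  hdot_norm : forall u : H, `|u| ^+ 2 = hdot u u
}.

#[short(type="hilbertType")]
HB.structure Definition Hilbert (R : realType) :=
  {H of isHilbert R H & CompleteNormedModule R[i] H}.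

(* Norms over R[i] take values in R[i]; [rnorm] is the same norm in R. *)
Definition rnorm (R : realType) (V : normedZmodType R[i]) (v : V) : R :=
  complex.Re `|v|.

Definition separable_space (T : topologicalType) : Prop :=
  exists D : set T, countable D /\ dense D.

(** * Operators on a Hilbert space *)

(* Operators are plain functions H -> H, membership in B(H) being the
   predicate [bounded_op]; composition is [\o]. *)
Section Operators.
Context {R : realType} {H : hilbertType R}.
Implicit Types (A B P T : H -> H) (E : set H) (u v : H).

Definition bounded_op T : Prop :=
  linear T /\ exists c : R, forall v, `|T v| <= c%:C * `|v|.

Definition opnorm T : \bar R :=
  ereal_sup [set (rnorm (T v))%:E | v in [set v | rnorm v <= 1]].

(* The order of R[i] makes [0 <= z] say that z is real and nonnegative. *)
Definition positive_op T : Prop := forall v, 0 <= hdot (T v) v.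

Definition op_le A B : Prop := positive_op (B \- A).

(* For bounded T the witness exists and is unique by the Riesz representation
   theorem. *)
Definition adjoint T : H -> H :=
  xget (fun=> 0) [set S | bounded_op S /\
                          forall u v, hdot (T u) v = hdot u (S v)].

(* |T| is the positive square root of T^* T. *)
Definition absop T : H -> H :=
  xget (fun=> 0) [set P | [/\ bounded_op P, positive_op P
                            & P \o P = adjoint T \o T]].

Definition orthonormal_set E : Prop :=
  forall u v, E u -> E v -> hdot u v = (u == v)%:R.

(* A maximal orthonormal set. *)
Definition orthonormal_basis E : Prop :=
  orthonormal_set E /\ forall v, (forall e, E e -> hdot v e = 0) -> v = 0.

Definition onb : set H := xget set0 [set E | orthonormal_basis E].

(* The trace of a positive operator, valued in [0, +oo]; it does not depend on
   the chosen basis. *)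
Definition trace P : \bar R := (\esum_(e in onb) (complex.Re (hdot (P e) e))%:E)%E.

Definition trace_norm T : \bar R := trace (absop T).

Definition hilbert_schmidt T : Prop :=
  bounded_op T /\ (\esum_(e in onb) (rnorm (T e) ^+ 2)%:E < +oo)%E.

End Operators.

(** * C*-algebras *)

(* The norm is a real-valued field of the mixin: HB has no join of rings and
   normed Z-modules below [numDomainType], so that a ring cannot be a
   [completeNormedModType] without being a domain. *)
HB.mixin Record isCStar (R : realType) A of GRing.Algebra R[i] A := {
  cnorm : A -> R ;
  star : A -> A ;
  cnorm0_eq0 : forall a, cnorm a = 0 -> a = 0 ;
  cnormD_le : forall a b, cnorm (a + b) <= cnorm a + cnorm b ;
  cnormZ : forall (c : R[i]) a, cnorm (c *: a) = rnorm c * cnorm a ;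
  cnormM_le : forall a b, cnorm (a * b) <= cnorm a * cnorm b ;
  cnorm_complete : forall s : nat -> A,
    (forall e : R, 0 < e -> exists N : nat, forall m n : nat,
       (N <= m)%N -> (N <= n)%N -> cnorm (s m - s n) < e) ->
    exists a, forall e : R, 0 < e -> exists N : nat, forall n : nat,
       (N <= n)%N -> cnorm (s n - a) < e ;
  starD : forall a b, star (a + b) = star a + star b ;
  starZ : forall (c : R[i]) a, star (c *: a) = c^* *: star a ;
  starM : forall a b, star (a * b) = star b * star a ;
  starK : forall a, star (star a) = a ;
  cnorm_star_mul : forall a, cnorm (star a * a) = cnorm a ^+ 2
}.

#[short(type="cstarAlgType")]
HB.structure Definition CStarAlgebra (R : realType) :=
  {A of isCStar R A & GRing.Algebra R[i] A}.

Definition star_hom (R : realType) (A B : cstarAlgType R) (f : A -> B) : Prop :=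
  [/\ linear f, f 1 = 1, (forall a b, f (a * b) = f a * f b)
    & forall a, f (star a) = star (f a)].

(* (U, x) is the universal unital C*-algebra generated by d elements of norm at
   most M. *)
Definition universal_cstar (R : realType) (d : nat) (M : R)
    (U : cstarAlgType R) (x : 'I_d -> U) : Prop :=
  (forall i, cnorm (x i) <= M) /\
  forall (B : cstarAlgType R) (y : 'I_d -> B), (forall i, cnorm (y i) <= M) ->
    exists! f : U -> B, star_hom f /\ forall i, f (x i) = y i.

Section Maps.
Context {R : realType} {U : cstarAlgType R} {H : hilbertType R}.

(* The C*-algebra M_n(U) has the conjugate transpose as its involution, and its
   positive elements are the Y^* Y. *)
Definition mxstar n (Y : 'M[U]_n) : 'M[U]_n := \matrix_(i, j) star (Y j i).

Definition positive_mx n (X : 'M[U]_n) : Prop := exists Y, X = mxstar Y *m Y.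

(* The inequality is the positivity of [phi X_ij]_ij on the n-fold sum of H. *)
Definition completely_positive (phi : U -> H -> H) : Prop :=
  forall n (X : 'M[U]_n), positive_mx X -> forall h : 'I_n -> H,
    0 <= \sum_(i < n) \sum_(j < n) hdot (phi (X i j) (h j)) (h i).

Definition ucp (phi : U -> H -> H) : Prop :=
  [/\ forall a, bounded_op (phi a),
      forall (c : R[i]) a b v, phi (c *: a + b) v = c *: phi a v + phi b v,
      phi 1 = idfun & completely_positive phi].

Definition representation (pi : U -> H -> H) : Prop :=
  [/\ forall a, bounded_op (pi a),
      forall (c : R[i]) a b v, pi (c *: a + b) v = c *: pi a v + pi b v,
      pi 1 = idfun,
      forall a b, pi (a * b) = pi a \o pi b
    & forall a, pi (star a) = adjoint (pi a)].

End Maps.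

(** * Labels and words *)

(* (i, false) is the label x_i and (i, true) is the label x_i^*. *)
Definition label (d : nat) : finType := ('I_d * bool)%type.

Definition label_star d (a : label d) : label d := (a.1, ~~ a.2).

Section Words.
Context {R : realType} {U : cstarAlgType R} {H : hilbertType R} {d : nat}.
Variables (x : 'I_d -> U) (phi : U -> H -> H) (Rop : H -> H).
Implicit Types (a : label d) (s : seq (label d)).

Definition label_val a : U := if a.2 then star (x a.1) else x a.1.

Definition word_val s : U := \prod_(a <- s) label_val a.

Definition Tlabel a : H -> H := phi (label_val a).

Definition Tword s : H -> H := foldr (fun a T => Tlabel a \o T) idfun s.

Definition Sdefect a : H -> H :=
  phi (star (label_val a) * label_val a) \- (adjoint (Tlabel a) \o Tlabel a).

Definition edefect a (C : H -> H) : \bar R :=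
  sqrte (trace (Rop \o adjoint C \o Sdefect a \o C \o Rop)).

Definition delta_defect : \bar R := (\sum_a edefect a idfun ^+ 2)%E.

End Words.

Section Weighted.
Context {R : realType} {H : hilbertType R}.
Variable Rop : H -> H.
Implicit Types B : H -> H.

(* The infimum of the empty set is +oo. *)
Definition vartheta B : \bar R :=
  ereal_inf [set c%:E | c in [set c : R | 0 <= c /\
    op_le (B \o Rop \o Rop \o adjoint B) ((c ^+ 2)%:C \*: (Rop \o Rop))]].

Definition in_MR B : Prop :=
  [/\ bounded_op B, (vartheta B < +oo)%E & (vartheta (adjoint B) < +oo)%E].

Definition Lambda B : \bar R :=
  maxe (opnorm B) (maxe (vartheta B) (vartheta (adjoint B))).

End Weighted.

(** * The word encoding *)

(* A noncommutative *-polynomial is given by its coefficient function on words;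
   as there are finitely many words of each length, a homogeneous one has
   finite support. *)
Record poly_family (R : realType) (d : nat) := PolyFamily {
  pdeg : nat -> nat ;
  pcoef : nat -> seq (label d) -> R[i] ;
  pcoef_homog : forall i w, pcoef i w != 0 -> size w = pdeg i ;
  pdeg0 : pdeg 0 = 0%N ;
  pcoef0 : pcoef 0 [::] = 1 ;
  pdegS : forall i, (1 <= pdeg i.+1)%N ;
  pspan : forall w, exists (N : nat) (b : nat -> R[i]),
    forall v, \sum_(i < N) b i * pcoef i v = (v == w)%:R
}.

Section Encoding.
Context {R : realType} {U : cstarAlgType R} {H K : hilbertType R} {d : nat}.
Variables (x : 'I_d -> U) (Rop : H -> H) (p : poly_family R d).

Definition pval (i : nat) : U :=
  \sum_(w : (pdeg p i).-tuple (label d)) pcoef p i w *: word_val x w.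

Definition pabs (i : nat) : R :=
  \sum_(w : (pdeg p i).-tuple (label d)) rnorm (pcoef p i w).

Definition pweight (i : nat) : R :=
  if i is 0 then 1 else 2 ^- i / ((pdeg p i)`!%:R * Num.max 1 (pabs i)).

Definition Qblock (psi : U -> H -> H) (i j : nat) : H -> H :=
  (pweight i * pweight j)%:C \*: (Rop \o psi (star (pval i) * pval j) \o Rop).

(* [J i u] is the elementary tensor e_i (x) u: these conditions determine
   (K, J) as l^2(N) (x) H up to a unique unitary. *)
Definition l2_tensor (J : nat -> H -> K) : Prop :=
  [/\ forall i, linear (J i),
      forall i j u v, hdot (J i u) (J j v) = (i == j)%:R * hdot u v
    & forall k, (forall i u, hdot k (J i u) = 0) -> k = 0].

(* The bounded operator on K with blocks B i j. Uniqueness follows from the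
   totality of the ranges of the J i. *)
Definition block_op (J : nat -> H -> K) (B : nat -> nat -> H -> H) : K -> K :=
  xget (fun=> 0) [set Q | bounded_op Q /\
    forall i j u v, hdot (Q (J j v)) (J i u) = hdot (B i j v) u].

Definition Qop (J : nat -> H -> K) (psi : U -> H -> H) : K -> K :=
  block_op J (Qblock psi).

End Encoding.

(* Main.v *)
Require Import Defs.
From HB Require Import structures.
From mathcomp Require Import all_boot all_order all_algebra sesquilinear.
From mathcomp Require Import all_classical all_reals all_analysis.
From mathcomp Require Import complex ring lra zify.

Set Implicit Arguments.
Unset Strict Implicit.
Unset Printing Implicit Defensive.

Import Order.TTheory GRing.Theory Num.Theory.
Import numFieldNormedType.Exports.

Local Open Scope classical_set_scope.
Local Open Scope complex_scope.
Local Open Scope ring_scope.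

(** Let [phi = V^* pi V] be a Stinespring dilation and [P = V V^*].  Inserting
   [1 = P + (1 - P)] between the letters of [pi(a_1) ... pi(a_n)] and sorting by
   the first and the last occurrence of [1 - P] writes [phi(w) - T_w] as a sum
   over pairs [i < j] of products
   [A_i^* pi(a_{i+1} ... a_{j-1}) B_j], where [B_j = (1 - P) pi(a_j) V T_{a_{j+1}} ... T_{a_n}]
   and [A_i] is built in the same way from [a_i^*] and the prefix of the word.
   Multiplied by [R], the outer factors are Hilbert-Schmidt operators with norms
   the contextual defects [e_R], because [V^* pi(a)^* (1 - P) pi(a) V] is the
   Schwarz defect [S_phi(a)], and the middle factor is bounded by the product of
   the norms of its letters.  This is the first inequality.

   The dilation is used only through its inner product, a positive
   semidefinite form on formal sums of pairs [(a, h)] ([dform]).  In terms of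
   [phi], the product belonging to [(i, j)] is a second difference of the
   partially compressed words, so that the expansion is a telescoping sum
   ([word_expansion]), and its matrix entries are estimated by the Cauchy-Schwarz
   inequality and the contractivity of [pi] ([second_difference_le]).
   Contractivity holds because [|m|^2 + eps - m^* m] is a square in the
   C*-algebra ([exists_contraction_gap]).

   Trace norms are estimated by duality: [X] has trace norm at most [c] when
   [|\sum_k <X e_k, f_k>| <= c] for all finite Bessel families ([trace_norm_le]).
   The substitute for the polar decomposition is the contraction
   [X (|X| + eps)^-1], whose resolvent comes from the Lax-Milgram lemma, as does
   the Riesz representation theorem and hence the existence of adjoints.  Such
   sums are compared with traces in [sum_form_le_trace], by a decomposition of a
   positive form into finitely many rank-one forms that is exact on given vectors.

   The same comparison lemma shows that replacing [R] by [C R] in a defect costs at most the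
   factor [c] when [C R^2 C^* <= c^2 R^2] ([rdefect_le]).  By induction on the word,
   contexts cost at most the products of the [vartheta_R].  In the uniform case each of
   the [C(n, 2)] pairs contributes at most [K^(n-2) delta_R].

   For the encoding, the duality bound passes from the blocks to the block operator, which
   is the norm limit of its finite parts: [c_i |p_i| <= 2^-i e^K].  The block [(i, j)] of the
   difference is bounded by [2^-i 2^-j C(m + n, 2) K^(m+n-2) / (m! n!)] times [delta_R],
   [m] and [n] being the degrees of [p_i] and [p_j].  Splitting
   [C(m + n, 2) = C(m, 2) + C(n, 2) + m n], the first row and the first column sum to
   at most [e^K], and the other blocks to at most [2 e^(2K)]. *)

Local Notation Re := complex.Re.
Local Notation Im := complex.Im.

(** * Complex scalars and positive forms *)

Section Scalars.
Context {R : realType}.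
Implicit Types (z b c : R[i]) (V : normedModType R[i]).

Lemma conjcM z c : (z * c)^* = z^* * c^*.
Proof. exact: rmorphM. Qed.

Lemma conjcN z : (- z)^* = - z^*.
Proof. exact: rmorphN. Qed.

Lemma conjcD z c : (z + c)^* = z^* + c^*.
Proof. exact: rmorphD. Qed.

Lemma conjcR (r : R) : (r%:C)^* = r%:C.
Proof. exact: conjc_real. Qed.

Lemma rnormE (V : normedZmodType R[i]) (v : V) : (rnorm v)%:C = `|v|.
Proof. by rewrite RRe_real // normr_real. Qed.

Lemma rnorm_ge0 (V : normedZmodType R[i]) (v : V) : 0 <= rnorm v.
Proof. by rewrite -ler0c rnormE. Qed.

Lemma ler_rnormD (V : normedZmodType R[i]) (u v : V) :
  rnorm (u + v) <= rnorm u + rnorm v.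
Proof. by rewrite -lecR rmorphD /= !rnormE ler_normD. Qed.

Lemma rnorm0 (V : normedZmodType R[i]) : rnorm (0 : V) = 0.
Proof. by rewrite /rnorm normr0. Qed.

Lemma rnormN (V : normedZmodType R[i]) (v : V) : rnorm (- v) = rnorm v.
Proof. by rewrite /rnorm normrN. Qed.

Lemma rnorm_eq0 (V : normedZmodType R[i]) (v : V) : rnorm v = 0 -> v = 0.
Proof. by move=> h; apply/normr0_eq0; rewrite -rnormE h. Qed.

Lemma rdistrC (V : normedZmodType R[i]) (u v : V) : rnorm (u - v) = rnorm (v - u).
Proof. by rewrite /rnorm distrC. Qed.

Lemma ler_rnorm_sum (V : normedZmodType R[i]) I (r : seq I) (P : pred I) (F : I -> V) :
  rnorm (\sum_(i <- r | P i) F i) <= \sum_(i <- r | P i) rnorm (F i).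
Proof.
elim/big_rec2: _ => [|i y x _ h]; first by rewrite rnorm0.
by apply: le_trans (ler_rnormD _ _) _; rewrite lerD2l.
Qed.

Lemma rnormZ V c (v : V) : rnorm (c *: v) = rnorm c * rnorm v.
Proof. by apply/complexI; rewrite rmorphM /= !rnormE normrZ. Qed.

Lemma rnormM z c : rnorm (z * c) = rnorm z * rnorm c.
Proof. by apply/complexI; rewrite rmorphM /= !rnormE normrM. Qed.

Lemma rnormJ z : rnorm z^* = rnorm z.
Proof. by rewrite /rnorm norm_conjC. Qed.

Lemma rnorm_real (r : R) : rnorm r%:C = `|r|.
Proof. by rewrite /rnorm normc_def /= expr0n addr0 sqrtr_sqr. Qed.

Lemma rnorm_nneg (r : R) : 0 <= r -> rnorm r%:C = r.
Proof. by move=> r0; rewrite rnorm_real ger0_norm. Qed.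

Lemma rnorm1 : rnorm (1 : R[i]) = 1.
Proof. by rewrite (rnorm_real 1) normr1. Qed.

Lemma Re_le_rnorm z : Re z <= rnorm z.
Proof.
apply: le_trans (ler_norm _) _; rewrite -lecR rnormE; exact: normc_ge_Re.
Qed.

Lemma mulJ_rnorm z : z * z^* = (rnorm z ^+ 2)%:C.
Proof. by rewrite rmorphXn /= rnormE sqr_normc. Qed.

Lemma ReE_ge0 z : 0 <= z -> z = (Re z)%:C.
Proof. by move=> z0; rewrite RRe_real // ger0_real. Qed.

Lemma Re_ge0 z : 0 <= z -> 0 <= Re z.
Proof. by rewrite lecE => /andP[]. Qed.

Lemma ReD z c : Re (z + c) = Re z + Re c. Proof. by case: z c => ? ? []. Qed.
Lemma Re_sum I (r : seq I) (P : pred I) (F : I -> R[i]) :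
  Re (\sum_(i <- r | P i) F i) = \sum_(i <- r | P i) Re (F i).
Proof. exact: (big_morph _ ReD (erefl : Re 0 = 0)). Qed.

Lemma ReN z : Re (- z) = - Re z. Proof. by case: z. Qed.
Lemma ReJ z : Re z^* = Re z. Proof. by case: z. Qed.
Lemma ReZ (r : R) z : Re (r%:C * z) = r * Re z.
Proof. by case: z => a b /=; rewrite mul0r subr0. Qed.

(** Testing the form at [u + c v] for [c = 1] and [c = i] gives hermitian
   symmetry; testing at [c = - t b] and optimising over real [t] gives the
   Cauchy-Schwarz inequality.  Stating this for the four values of the form
   makes it available for every positive form used below, on whatever
   carrier. *)
Lemma psd_form_scalar (A b b' C : R[i]) :
  (forall c, 0 <= A + c^* * b + c * b' + c * c^* * C) -> 0 <= A -> 0 <= C ->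
  b' = b^* /\ rnorm b ^+ 2 <= Re A * Re C.
Proof.
move=> h A0 C0.
have bE : b' = b^*.
  have h1 := h 1; have h2 := h 'i.
  move: A0 C0 h1 h2; case: b {h} => x y; case: b' => x' y'.
  case: A => a1 a2; case: C => c1 c2 /=; simpc.
  move=> /andP[/eqP -> _] /andP[/eqP -> _] /andP[/eqP h1 _] /andP[/eqP h2 _].
  by congr (_ +i* _); lra.
split => //; subst b'.
have := (ReE_ge0 C0); have := (ReE_ge0 A0).
move: (Re A) (Re C) (Re_ge0 A0) (Re_ge0 C0) => A1 C1 a0 c0 AE CE; subst A C.
have q t : 0 <= A1 - 2 * t * rnorm b ^+ 2 + t ^+ 2 * rnorm b ^+ 2 * C1.
  have -> : A1 - 2 * t * rnorm b ^+ 2 + t ^+ 2 * rnorm b ^+ 2 * C1 =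
            Re (A1%:C + (- t%:C * b)^* * b + - t%:C * b * b^* +
                (- t%:C * b) * (- t%:C * b)^* * C1%:C).
    rewrite conjcM conjcN conjcR -!mulrA (mulrCA b) (mulrA b) (mulrC b^* b) mulJ_rnorm.
    by rewrite -!rmorphN -!rmorphM -!rmorphD /=; ring.
  exact/Re_ge0/h.
move: (rnorm b ^+ 2) (sqr_ge0 (rnorm b)) q => n n0 q.
move: c0; rewrite le_eqVlt => /predU1P[c0|c0].
  rewrite -c0 mulr0; move: n0; rewrite le_eqVlt => /predU1P[->//|n0].
  have := q ((A1 + 1) / (2 * n)); rewrite -c0 mulr0 addr0.
  have -> : 2 * ((A1 + 1) / (2 * n)) * n = A1 + 1 by field; rewrite gt_eqF.
  lra.
have := q C1^-1; have cn : C1 != 0 by rewrite gt_eqF.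
have -> : A1 - 2 * C1^-1 * n + C1^-1 ^+ 2 * n * C1 = A1 - n / C1 by field.
by rewrite subr_ge0 ler_pdivrMr.
Qed.

End Scalars.

(** * Linear maps *)

Section LinearMaps.
Context {K : pzRingType} {V W : lmodType K} {T : V -> W}.
Hypothesis hT : linear T.

Lemma linD u v : T (u + v) = T u + T v.
Proof. by have := hT 1 u v; rewrite !scale1r. Qed.

Lemma lin0 : T 0 = 0.
Proof. by apply: (addIr (T 0)); rewrite -linD !add0r. Qed.

Lemma linZ c u : T (c *: u) = c *: T u.
Proof. by have := hT c u 0; rewrite lin0 !addr0. Qed.

Lemma linN u : T (- u) = - T u.
Proof. by rewrite -scaleN1r linZ scaleN1r. Qed.

Lemma linB u v : T (u - v) = T u - T v.
Proof. by rewrite linD linN. Qed.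

Lemma lin_sum I (r : seq I) (P : pred I) (F : I -> V) :
  T (\sum_(i <- r | P i) F i) = \sum_(i <- r | P i) T (F i).
Proof. exact: (big_morph T linD lin0). Qed.

End LinearMaps.

(** * Limits with respect to a real-valued norm *)

Section Limits.
Context {R : realType} {V : zmodType} (nrm : V -> R).

(** The norm is a mere function, so that these notions apply both to Hilbert spaces,
   whose norms take values in [R[i]], and to C*-algebras. *)
Definition norm_cauchy (s : nat -> V) := forall e : R, 0 < e ->
  exists N : nat, forall m n : nat, (N <= m)%N -> (N <= n)%N -> nrm (s m - s n) < e.

Definition norm_cvg (s : nat -> V) (a : V) := forall e : R, 0 < e ->
  exists N : nat, forall n : nat, (N <= n)%N -> nrm (s n - a) < e.

Hypotheses (nrmD : forall a b, nrm (a + b) <= nrm a + nrm b) (nrm0 : nrm 0 = 0)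
  (nrmC : forall a b, nrm (a - b) = nrm (b - a)).

Lemma norm_cvgD s t a b :
  norm_cvg s a -> norm_cvg t b -> norm_cvg (fun n => s n + t n) (a + b).
Proof.
move=> sa tb e e0; have e2 : 0 < e / 2 by rewrite divr_gt0.
have [N1 h1] := sa _ e2; have [N2 h2] := tb _ e2.
exists (maxn N1 N2) => n; rewrite geq_max => /andP[/h1 l1 /h2 l2].
rewrite opprD addrACA [e]splitr; exact: le_lt_trans (nrmD _ _) (ltrD l1 l2).
Qed.

Lemma geometric_cauchy s (c q : R) : 0 <= c -> 0 <= q -> q < 1 ->
  (forall n, nrm (s n.+1 - s n) <= c * q ^+ n) -> norm_cauchy s.
Proof.
move=> c0 q0 q1 h.
have tele n k : nrm (s (n + k)%N - s n) <= c * q ^+ n / (1 - q) * (1 - q ^+ k).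
  elim: k => [|k IH]; first by rewrite addn0 subrr nrm0 expr0 subrr mulr0.
  have -> : s (n + k.+1)%N - s n = (s (n + k).+1 - s (n + k)%N) + (s (n + k)%N - s n).
    by rewrite addnS addrA subrK.
  apply: le_trans (nrmD _ _) _; apply: le_trans (lerD (h _) IH) _.
  by rewrite exprD exprS le_eqVlt; apply/orP; left; apply/eqP; field; rewrite subr_eq0 gt_eqF.
have tail n k : nrm (s (n + k)%N - s n) <= c / (1 - q) * q ^+ n.
  apply: le_trans (tele n k) _; rewrite (mulrAC c); apply: ler_piMr.
    by rewrite mulr_ge0 ?exprn_ge0 // divr_ge0 // subr_ge0 ltW.
  by rewrite lerBlDr lerDl exprn_ge0.
move=> e e0.
have [N hN] : exists N : nat, c / (1 - q) * q ^+ N < e / 2.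
  have := @cvg_geometric R (c / (1 - q)) q; rewrite ger0_norm // => /(_ q1).
  move/cvgrPdist_lt => /(_ (e / 2)); rewrite divr_gt0 // => /(_ isT)[N _ hN].
  exists N; apply: le_lt_trans (hN N (leqnn N)).
  by rewrite sub0r normrN; exact: ler_norm.
exists N => m n Nm Nn.
have -> : s m - s n = (s m - s N) + (s N - s n) by rewrite addrA subrK.
apply: le_lt_trans (nrmD _ _) _; rewrite (nrmC (s N)) [e]splitr.
by apply: ltrD; apply: le_lt_trans hN;
  [rewrite -(subnKC Nm)|rewrite -(subnKC Nn)]; exact: tail.
Qed.

Lemma norm_cvg_le s a (c : R) :
  norm_cvg s a -> (forall n, nrm (s n) <= c) -> nrm a <= c.
Proof.
move=> sa h; apply/ler_addgt0Pr => e e0; have [N hN] := sa e e0.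
have -> : a = s N + (a - s N) by rewrite addrC subrK.
by apply: le_trans (nrmD _ _) (lerD (h N) _); rewrite nrmC ltW ?hN.
Qed.

Lemma norm_cvg_unique s a b : (forall v, nrm v = 0 -> v = 0) ->
  (forall v, 0 <= nrm v) -> norm_cvg s a -> norm_cvg s b -> a = b.
Proof.
move=> eq0 ge0 sa sb; apply/eqP; rewrite -subr_eq0; apply/eqP/eq0/le_anti.
rewrite ge0 andbT; apply/ler_addgt0Pr => e e0; rewrite add0r.
have e2 : 0 < e / 2 by rewrite divr_gt0.
have [N1 h1] := sa _ e2; have [N2 h2] := sb _ e2.
have -> : a - b = (a - s (maxn N1 N2)) + (s (maxn N1 N2) - b) by rewrite addrA subrK.
apply: le_trans (nrmD _ _) _; rewrite nrmC [e]splitr lerD // ltW //.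
  by rewrite h1 // leq_maxl.
by rewrite h2 // leq_maxr.
Qed.

End Limits.

(** * Inner products *)

Section HilbertBasics.
Context {R : realType} {H : hilbertType R}.
Implicit Types (u v w : H) (c : R[i]).

Lemma hdotDl u v w : hdot (u + v) w = hdot u w + hdot v w.
Proof. exact: linearDl. Qed.

Lemma hdotDr u v w : hdot u (v + w) = hdot u v + hdot u w.
Proof. exact: linearDr. Qed.

Lemma hdotZl c u v : hdot (c *: u) v = c * hdot u v.
Proof. exact: linearZl_LR. Qed.

Lemma hdotZr c u v : hdot u (c *: v) = c^* * hdot u v.
Proof. exact: linearZr_LR. Qed.

Lemma hdotC u v : hdot u v = (hdot v u)^*.
Proof. by have := hermC hdot u v; rewrite expr0 mul1r. Qed.

Lemma hdot0l u : hdot 0 u = 0.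
Proof. exact: linear0l. Qed.

Lemma hdot0r u : hdot u 0 = 0.
Proof. exact: linear0r. Qed.

Lemma hdotNl u v : hdot (- u) v = - hdot u v.
Proof. exact: linearNl. Qed.

Lemma hdotNr u v : hdot u (- v) = - hdot u v.
Proof. exact: linearNr. Qed.

Lemma hdotBl u v w : hdot (u - v) w = hdot u w - hdot v w.
Proof. by rewrite hdotDl hdotNl. Qed.

Lemma hdotBr u v w : hdot u (v - w) = hdot u v - hdot u w.
Proof. by rewrite hdotDr hdotNr. Qed.

Lemma hdot_suml I (r : seq I) (P : pred I) (F : I -> H) v :
  hdot (\sum_(i <- r | P i) F i) v = \sum_(i <- r | P i) hdot (F i) v.
Proof.
by apply: (big_morph (hdot^~ v)) => [u w|]; rewrite ?hdotDl ?hdot0l.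
Qed.

Lemma hdot_sumr I (r : seq I) (P : pred I) (F : I -> H) v :
  hdot v (\sum_(i <- r | P i) F i) = \sum_(i <- r | P i) hdot v (F i).
Proof.
by apply: (big_morph (hdot v)) => [u w|]; rewrite ?hdotDr ?hdot0r.
Qed.

Lemma hdot_rnorm u : hdot u u = (rnorm u ^+ 2)%:C.
Proof. by rewrite rmorphXn /= rnormE hdot_norm. Qed.

Lemma Re_hdot u : Re (hdot u u) = rnorm u ^+ 2.
Proof. by rewrite hdot_rnorm. Qed.

Lemma hdotP u v : (forall w, hdot u w = hdot v w) -> u = v.
Proof.
move=> h; apply/eqP; rewrite -subr_eq0; apply/eqP/rnorm_eq0/eqP.
by rewrite -sqrf_eq0 -Re_hdot hdotBl h subrr.
Qed.

Lemma rnorm_sqrD u v :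
  rnorm (u + v) ^+ 2 = rnorm u ^+ 2 + 2 * Re (hdot u v) + rnorm v ^+ 2.
Proof.
rewrite -!Re_hdot !hdotDl !hdotDr !ReD (hdotC v u) ReJ; ring.
Qed.

Section PositiveOperator.
Variable S : H -> H.
Hypotheses (linS : linear S) (posS : positive_op S).

Lemma positive_op_form u v : hdot (S v) u = (hdot (S u) v)^* /\
  rnorm (hdot (S u) v) ^+ 2 <= Re (hdot (S u) u) * Re (hdot (S v) v).
Proof.
apply: psd_form_scalar => [c||]; [|exact: posS|exact: posS].
have := posS (u + c *: v); rewrite (linD linS) (linZ linS).
rewrite !hdotDl !hdotDr !hdotZl !hdotZr.
by rewrite !addrA (mulrA c) -(addrA (hdot (S u) u)) (addrC (c^* * _)) !addrA.
Qed.

Lemma positive_op_sym u v : hdot (S u) v = hdot u (S v).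
Proof. by rewrite (positive_op_form v u).1 -hdotC. Qed.

End PositiveOperator.

Lemma CauchySchwarz u v : rnorm (hdot u v) <= rnorm u * rnorm v.
Proof.
rewrite -ler_sqr ?nnegrE ?mulr_ge0 ?rnorm_ge0 // exprMn -!Re_hdot.
have pos : positive_op (@idfun H) by move=> w /=; rewrite hdot_rnorm ler0c sqr_ge0.
by have [] := positive_op_form (S := idfun) (fun _ _ _ => erefl) pos u v.
Qed.

Lemma hilbert_complete (s : nat -> H) : norm_cauchy (@rnorm R H) s ->
  exists a, norm_cvg (@rnorm R H) s a.
Proof.
move=> cs.
have /cauchy_cvg sl : cauchy (s @ \oo).
  apply/cauchy_ballP => e e0.
  have eR : e = (Re e)%:C by apply: ReE_ge0; exact: ltW.
  have e1 : 0 < Re e by rewrite -ltcR -eR.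
  have [N hN] := cs _ e1.
  near=> x; near: x.
  exists (s @` [set n | (N <= n)%N], s @` [set n | (N <= n)%N]).
    by split; exists N => // n /= Nn; exists n.
  move=> [x y] [/= [m Nm <-] [n Nn <-]]; rewrite -ball_normE /=.
  by rewrite -rnormE eR ltcR; exact: hN.
exists (lim (s @ \oo)) => e e0.
have /cvgrPdist_lt /(_ e%:C) : s @ \oo --> lim (s @ \oo) by [].
rewrite (ltcR 0) e0 => /(_ isT)[N _ hN]; exists N => n Nn.
by have := hN n Nn; rewrite /= -rnormE ltcR rdistrC.
Unshelve. all: end_near.
Qed.

End HilbertBasics.

(** * The Riesz theorem and adjoints *)

Section LaxMilgram.
Context {R : realType} {H : hilbertType R} (A : H -> H) (f : H -> R[i]).
Variables (eps c k : R).
Hypotheses (linA : linear A) (posA : positive_op A)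
  (bndA : forall v, rnorm (A v) <= c * rnorm v) (eps0 : 0 < eps)
  (coerA : forall v, eps * rnorm v ^+ 2 <= Re (hdot (A v) v))
  (linf : forall a u v, f (a *: u + v) = a * f u + f v)
  (bndf : forall v, rnorm (f v) <= k * rnorm v).

Let energy u := Re (hdot (A u) u) / 2 - Re (f u).
Let slope u w := Re (hdot (A u) w) - Re (f w).

Let energyD u (t : R) w : energy (u + t%:C *: w) =
  energy u + t * slope u w + t ^+ 2 / 2 * Re (hdot (A w) w).
Proof.
have fD : f (u + t%:C *: w) = t%:C * f w + f u by rewrite addrC linf.
rewrite /energy /slope fD (linD linA) (linZ linA) !hdotDl !hdotDr !hdotZl !hdotZr.
rewrite (positive_op_form linA posA u w).1 conjcR !ReD !ReZ ReJ.
by field.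
Qed.

Let energy_ge u : - (k ^+ 2 / (2 * eps)) <= energy u.
Proof.
have h1 := coerA u; have h2 := le_trans (Re_le_rnorm _) (bndf u).
rewrite /energy; move: (rnorm u) (Re _) (Re (f u)) h1 h2 => n a b h1 h2.
have : 0 <= (eps * n - k) ^+ 2 / (2 * eps).
  by rewrite divr_ge0 ?sqr_ge0 // mulr_ge0 // ltW.
have -> : (eps * n - k) ^+ 2 / (2 * eps) =
  eps * n ^+ 2 / 2 - k * n + k ^+ 2 / (2 * eps) by field; rewrite gt_eqF.
lra.
Qed.

(** The energy [u |-> <Au,u>/2 - Re f u] is bounded below, a minimising sequence
   is Cauchy by the parallelogram identity and coercivity, and the first
   variation vanishes at its limit. *)
Lemma lax_milgram : exists u, forall w, f w = hdot w (A u).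
Proof.
pose m := inf (range energy).
have hinf : has_inf (range energy).
  split; first by exists (energy 0); exists 0.
  by exists (- (k ^+ 2 / (2 * eps))) => _ [u _ <-]; exact: energy_ge.
have mle u : m <= energy u by apply: (ge_inf hinf.2); exists u.
have /choice[s sP] : forall n : nat, exists u, energy u < m + n.+1%:R^-1.
  move=> n; have n0 : 0 < n.+1%:R^-1 :> R by rewrite invr_gt0.
  by have [_ [u _ <-] ltu] := inf_adherent n0 hinf; exists u.
have sc : norm_cauchy (@rnorm R H) s.
  (* With [u, u'] within [d] of the minimum of the energy, the parallelogram
     identity gives [eps |u - u'|^2 / 4 < 2 d]. *)
  move=> e e0; have d0 : 0 < eps * e ^+ 2 / 8 by rewrite divr_gt0 // mulr_gt0 // exprn_gt0.
  have [N _ hN] := near_infty_natSinv_lt (PosNum d0); exists N => i j Ni Nj.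
  have {}hN n : (N <= n)%N -> energy (s n) < m + eps * e ^+ 2 / 8.
    by move=> Nn; apply: lt_trans (sP n) _; rewrite ltrD2l; exact: hN.
  have := energyD (s j) 1 (s i - s j); have := energyD (s j) 2^-1 (s i - s j).
  rewrite scale1r (addrC (s j) (s i - _)) subrK => h1 h2.
  have := mle (s j + 2^-1%:C *: (s i - s j)); rewrite h1.
  have := coerA (s i - s j); move: (hN i Ni) (hN j Nj).
  rewrite h2; move: (rnorm_ge0 (s i - s j)).
  move: (energy _) (slope _ _) (Re _) (rnorm _) {h1 h2} => E L Q n n0 l1 l2 l3 l4.
  rewrite -ltr_sqr ?nnegrE ?(ltW e0) // -(ltr_pM2l eps0).
  apply: le_lt_trans l3 _; lra.
have [u ul] := hilbert_complete sc.
have slope0 w : slope u w = 0.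
  set Q := Re (hdot (A w) w); have Q0 : 0 <= Q by exact/Re_ge0/posA.
  (* The increment [t slope + t^2 Q / 2] is at least [- 1/(n + 1)] at the [n]-th
     approximate minimiser; the error disappears in the limit. *)
  have var t : 0 <= t * slope u w + t ^+ 2 / 2 * Q.
    apply/ler_addgt0Pr => e e0; have e2 : 0 < e / 2 by rewrite divr_gt0.
    pose r := `|t| * (`|c| * rnorm w) + 1.
    have r0 : 0 < r by rewrite ltr_wpDl // !mulr_ge0 // ?rnorm_ge0.
    have [N1 h1] := ul _ (divr_gt0 e2 r0).
    have [N2 _ h2] := near_infty_natSinv_lt (PosNum e2).
    pose n := maxn N1 N2.
    have := mle (s n + t%:C *: w); rewrite energyD -/Q.
    have := h2 n (leq_maxr _ _); have := h1 n (leq_maxl _ _); have := sP n => /=.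
    have -> : slope (s n) w = slope u w + Re (hdot (A (s n - u)) w).
      by rewrite /slope (linB linA) hdotBl ReD ReN; ring.
    have l5 : t * Re (hdot (A (s n - u)) w) <= r * rnorm (s n - u).
      apply: le_trans (ler_norm _) _; rewrite normrM.
      have l6 : `|Re (hdot (A (s n - u)) w)| <= (`|c| * rnorm w) * rnorm (s n - u).
        rewrite ler_norml lerNl -ReN -hdotNl.
        have aux x : rnorm x = rnorm (A (s n - u)) ->
            Re (hdot x w) <= `|c| * rnorm w * rnorm (s n - u).
          move=> xE; apply: le_trans (Re_le_rnorm _) _.
          apply: le_trans (CauchySchwarz _ _) _; rewrite xE mulrAC ler_wpM2r ?rnorm_ge0 //.
          apply: le_trans (bndA _) _; rewrite ler_wpM2r ?rnorm_ge0 //; exact: ler_norm.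
        by rewrite !aux // rnormN.
      apply: le_trans (ler_wpM2l (normr_ge0 _) l6) _; rewrite mulrA.
      by rewrite ler_wpM2r ?rnorm_ge0 // /r lerDl.
    rewrite (ltr_pdivlMr _ _ r0) (mulrC (rnorm _)) /=.
    move: l5; move: (Re (hdot _ _)) (rnorm (s n - u)) (n.+1%:R^-1) => x y z.
    move: (energy _) (slope _ _) => E L l5 l1 l2 l3 l4; lra.
  have := var (- slope u w / (Q + 1)).
  move: (slope u w) => L h; apply/eqP; rewrite -sqrf_eq0; apply/eqP/le_anti.
  rewrite sqr_ge0 andbT.
  have Q1 : 0 < Q + 1 by rewrite ltr_wpDl.
  have : - L / (Q + 1) * L + (- L / (Q + 1)) ^+ 2 / 2 * Q =
         - (L ^+ 2 * ((Q + 2) / (2 * (Q + 1) ^+ 2))) by field; rewrite gt_eqF.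
  move=> E; move: h; rewrite E oppr_ge0 pmulr_lle0 //.
  by rewrite divr_gt0 ?mulr_gt0 ?exprn_gt0 // ltr_wpDl.
exists u => w.
have f0 : f 0 = 0.
  by apply: (addIr (f 0)); have := linf 1 0 0; rewrite scale1r mul1r addr0 add0r.
(* A linear functional is determined by its real part, evaluated at [w] and [i w]. *)
have ReE v : Re (f v) = Re (hdot v (A u)).
  by have := slope0 v; rewrite /slope hdotC ReJ => /eqP; rewrite subr_eq0 => /eqP.
have := ReE w; have := ReE ('i *: w).
have -> : f ('i *: w) = 'i * f w by have := linf 'i w 0; rewrite addr0 f0 addr0.
rewrite hdotZl; case: (f w) => a b; case: (hdot _ _) => a' b' /=.
by rewrite !mul0r !mul1r !sub0r => /oppr_inj -> ->.
Qed.

End LaxMilgram.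

Section Adjoint.
Context {R : realType}.

Lemma exists_adjoint (H K : hilbertType R) (T : H -> K) (c : R) : 0 <= c ->
  linear T -> (forall v, rnorm (T v) <= c * rnorm v) ->
  exists S : K -> H, [/\ linear S, forall v, rnorm (S v) <= c * rnorm v
    & forall u v, hdot (T u) v = hdot u (S v)].
Proof.
move=> c0 linT bndT.
have /choice[S SP] : forall v, exists s, forall w, hdot (T w) v = hdot w s.
  move=> v; apply: (@lax_milgram R H idfun _ 1 1 (c * rnorm v)) => //.
  - by move=> u /=; rewrite mul1r.
  - by move=> u /=; rewrite mul1r Re_hdot.
  - by move=> a u w; rewrite linT hdotDl hdotZl.
  - move=> u; apply: le_trans (CauchySchwarz _ _) _.
    by rewrite mulrAC ler_wpM2r ?rnorm_ge0.
have SP' u v : hdot (T u) v = hdot u (S v) by rewrite -SP.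
exists S; split => // [a u v|v].
  apply: hdotP => w; rewrite hdotC -SP' hdotDr hdotZr !SP'.
  by rewrite hdotDl hdotZl (hdotC (S u)) (hdotC (S v)) conjcD conjcM conjCK.
have := CauchySchwarz (T (S v)) v; rewrite SP' hdot_rnorm rnorm_nneg ?sqr_ge0 //.
move=> h; have [->|/eqP n0] := eqVneq (rnorm (S v)) 0; first by rewrite mulr_ge0 ?rnorm_ge0.
have {}n0 : 0 < rnorm (S v) by rewrite lt_neqAle rnorm_ge0 andbT eq_sym; apply/eqP.
rewrite -(ler_pM2l n0) -expr2; apply: le_trans h _.
by rewrite mulrA (mulrC (rnorm (S v))) ler_wpM2r ?rnorm_ge0.
Qed.

Context {H : hilbertType R}.
Implicit Types (T S : H -> H).

Lemma bounded_opP T : bounded_op T <-> linear T /\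
  exists2 c : R, 0 <= c & forall v, rnorm (T v) <= c * rnorm v.
Proof.
split=> [[linT [c hc]]|[linT [c c0 hc]]]; split => //.
  exists `|c| => // v; rewrite -lecR rmorphM /= !rnormE; apply: le_trans (hc v) _.
  by rewrite ler_wpM2r // lecR ler_norm.
by exists c => v; rewrite -!rnormE -rmorphM lecR.
Qed.

Lemma adjointP T : bounded_op T -> bounded_op (adjoint T) /\
  forall u v, hdot (T u) v = hdot u (adjoint T v).
Proof.
move=> /bounded_opP[linT [c c0 bT]]; rewrite /adjoint; case: xgetP => [S _ //|noS].
have [S [linS bS adj]] := exists_adjoint c0 linT bT.
by case: (noS S); split => //; apply/bounded_opP; split => //; exists c.
Qed.

Lemma adjoint_unique T S : bounded_op S ->
  (forall u v, hdot (T u) v = hdot u (S v)) -> adjoint T = S.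
Proof.
move=> bS adj; rewrite /adjoint; case: xgetP => [S' _ [_ adj']|noS]; last first.
  by case: (noS S).
by apply/funext => v; apply: hdotP => w; rewrite !(hdotC _ w) -adj' -adj.
Qed.

Lemma adjointK T : bounded_op T -> adjoint (adjoint T) = T.
Proof.
move=> bT; have [_ adj] := adjointP bT; apply: adjoint_unique => // u v.
by rewrite hdotC -adj -hdotC.
Qed.

Lemma bounded_id : bounded_op (@idfun H).
Proof. by apply/bounded_opP; split => //; exists 1 => // v; rewrite mul1r. Qed.

Lemma bounded_comp T S : bounded_op T -> bounded_op S -> bounded_op (T \o S).
Proof.
move=> /bounded_opP[lT [c c0 bT]] /bounded_opP[lS [k k0 bS]]; apply/bounded_opP.
split=> [a u v /=|]; first by rewrite lS lT.
exists (c * k); first by rewrite mulr_ge0.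
by move=> v /=; apply: le_trans (bT _) _; rewrite -mulrA ler_wpM2l.
Qed.

Lemma bounded_sub T S : bounded_op T -> bounded_op S -> bounded_op (T \- S).
Proof.
move=> /bounded_opP[lT [c c0 bT]] /bounded_opP[lS [k k0 bS]]; apply/bounded_opP.
split=> [a u v /=|]; first by rewrite lS lT scalerBr opprD addrACA.
exists (c + k); first by rewrite addr_ge0.
move=> v /=; apply: le_trans (ler_rnormD _ _) _.
by rewrite rnormN mulrDl lerD.
Qed.

Lemma adjoint_comp T S : bounded_op T -> bounded_op S ->
  adjoint (T \o S) = adjoint S \o adjoint T.
Proof.
move=> bT bS; have [bT' aT] := adjointP bT; have [bS' aS] := adjointP bS.
by apply: adjoint_unique => [|u v /=]; [exact: bounded_comp|rewrite aT aS].
Qed.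

End Adjoint.

(** * Orthonormal bases and the trace *)

Section Orthonormal.
Context {R : realType} {H : hilbertType R}.
Implicit Types (u v w h : H) (E : set H) (s : seq H).

Lemma rnorm_hdotC u v : rnorm (hdot u v) = rnorm (hdot v u).
Proof. by rewrite hdotC rnormJ. Qed.

Definition proj_seq s v := \sum_(e <- s) hdot v e *: e.

Definition coord_sqr s v := \sum_(e <- s) rnorm (hdot v e) ^+ 2.

Definition finite_in E s := uniq s /\ forall e, e \in s -> E e.

Section Projection.
Variables (E : set H) (s : seq H).
Hypotheses (onE : orthonormal_set E) (sE : finite_in E s).

Lemma hdot_proj v e : e \in s -> hdot (proj_seq s v) e = hdot v e.
Proof.
move=> es; have [us subE] := sE.
rewrite /proj_seq hdot_suml (bigD1_seq e) //= hdotZl.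
rewrite (onE (subE _ es) (subE _ es)) eqxx mulr1.
rewrite big_seq_cond big1 ?addr0 // => x /andP[xs xe].
by rewrite hdotZl (onE (subE _ xs) (subE _ es)) (negPf xe) mulr0.
Qed.

Lemma rnorm_proj v : rnorm (proj_seq s v) ^+ 2 = coord_sqr s v.
Proof.
rewrite -Re_hdot {1}/proj_seq hdot_suml Re_sum /coord_sqr !big_seq.
by apply: eq_bigr => e es; rewrite hdotZl (hdotC e) hdot_proj // mulJ_rnorm.
Qed.

Lemma rnorm_sub_proj v :
  rnorm (v - proj_seq s v) ^+ 2 = rnorm v ^+ 2 - coord_sqr s v.
Proof.
rewrite rnorm_sqrD hdotNr rnormN rnorm_proj ReN.
have -> : Re (hdot v (proj_seq s v)) = coord_sqr s v.
  rewrite /proj_seq hdot_sumr Re_sum; apply: eq_bigr => e _.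
  by rewrite hdotZr mulrC mulJ_rnorm.
ring.
Qed.

Lemma Bessel v : coord_sqr s v <= rnorm v ^+ 2.
Proof. by rewrite -subr_ge0 -rnorm_sub_proj sqr_ge0. Qed.

End Projection.

Lemma rnorm_proj_sub E s t v : orthonormal_set E -> finite_in E s -> finite_in E t ->
  {subset s <= t} ->
  rnorm (proj_seq t v - proj_seq s v) ^+ 2 = coord_sqr t v - coord_sqr s v.
Proof.
move=> onE sE tE st.
have pE : proj_seq s v = proj_seq s (proj_seq t v).
  rewrite [LHS]/proj_seq [RHS]/proj_seq !big_seq; apply: eq_bigr => e /st et.
  by rewrite (hdot_proj onE tE).
have cE : coord_sqr s v = coord_sqr s (proj_seq t v).
  by rewrite /coord_sqr !big_seq; apply: eq_bigr => e /st et; rewrite (hdot_proj onE tE).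
by rewrite pE (rnorm_sub_proj onE sE) (rnorm_proj onE tE) -cE.
Qed.

Lemma finite_in_union E s t : finite_in E s -> finite_in E t ->
  finite_in E (undup (s ++ t)).
Proof.
move=> [_ sE] [_ tE]; split; first exact: undup_uniq.
by move=> e; rewrite mem_undup mem_cat => /orP[/sE|/tE].
Qed.

Lemma sub_union_l s t : {subset s <= undup (s ++ t)}.
Proof. by move=> e es; rewrite mem_undup mem_cat es. Qed.

Lemma sub_union_r s t : {subset t <= undup (s ++ t)}.
Proof. by move=> e es; rewrite mem_undup mem_cat es orbT. Qed.

Lemma coord_sqr_sub E s t v : orthonormal_set E -> finite_in E s -> finite_in E t ->
  {subset s <= t} -> coord_sqr s v <= coord_sqr t v.
Proof.
by move=> onE sE tE st; rewrite -subr_ge0 -(rnorm_proj_sub _ onE sE tE st) sqr_ge0.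
Qed.

Lemma exists_orthonormal_basis : exists E : set H, orthonormal_basis E.
Proof.
have [F tF totF|E [onE maxE]] := @Zorn_bigcup H (@orthonormal_set R H).
  move=> u v [A FA Au] [B FB Bv].
  have [AB|BA] := totF _ _ FA FB; first exact: (tF _ FB u v (AB _ Au) Bv).
  exact: (tF _ FA u v Au (BA _ Bv)).
exists E; split => // v vE; apply: contrapT => /eqP v0.
have n0 : 0 < rnorm v.
  by rewrite lt_neqAle rnorm_ge0 andbT eq_sym; apply: contraNneq v0 => /rnorm_eq0 ->.
pose w := (rnorm v)^-1%:C *: v.
have wE e : E e -> hdot w e = 0 by move=> Ee; rewrite hdotZl vE ?mulr0.
have ww : hdot w w = 1.
  rewrite hdotZl hdotZr conjcR hdot_rnorm -!rmorphM /=; congr (_%:C).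
  by field; rewrite gt_eqF.
have w0 : w != 0.
  by apply/eqP => w0; move: ww; rewrite w0 hdot0l => /eqP; rewrite eq_sym oner_eq0.
have nEw : ~ E w by move=> /wE; rewrite ww => /eqP; rewrite oner_eq0.
apply: (maxE (E `|` [set w])).
  by split=> [e Ee|sub]; [left|apply: nEw; apply: sub; right].
move=> a b [Ea|->] [Eb|->]; first exact: onE.
- rewrite hdotC wE // conjC0; case: eqVneq => // aw.
  by case: nEw; rewrite -aw.
- rewrite wE //; case: eqVneq => // aw; by case: nEw; rewrite aw.
- by rewrite ww eqxx.
Qed.

Lemma onbP : orthonormal_basis (@onb R H).
Proof.
have [E basE] := exists_orthonormal_basis.
by rewrite /onb; case: xgetP => [E' _ //|noE]; case: (noE E).
Qed.

Lemma onb_orthonormal : orthonormal_set (@onb R H).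
Proof. by have [] := onbP. Qed.

(** The finite projections of [h] form a Cauchy net because their squared norms
   increase and are bounded by that of [h]; by maximality of the basis the
   limit can only be [h]. *)
Lemma Parseval h (eps : R) : 0 < eps -> exists2 s, finite_in (@onb R H) s &
  rnorm (h - proj_seq s h) < eps.
Proof.
move=> eps0; have [onE maxE] := onbP; set E := onb in onE maxE *.
pose X := [set x : R | exists2 s, finite_in E s & x = coord_sqr s h].
have supX : has_sup X.
  split; first by exists 0, [::]; rewrite /coord_sqr ?big_nil.
  by exists (rnorm h ^+ 2) => _ [s sE ->]; exact: (Bessel onE sE).
(* Once [coord_sqr s h] is within [d^2] of its supremum, enlarging [s] moves the
   projection by less than [d]. *)
have near_sup (d : R) : 0 < d -> exists2 s, finite_in E s & forall t, finite_in E t ->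
    {subset s <= t} -> rnorm (proj_seq t h - proj_seq s h) < d.
  move=> d0; have [|_ [s sE ->] lts] := @sup_adherent _ X (d ^+ 2) _ supX.
    by rewrite exprn_gt0.
  exists s => // t tE st; rewrite -ltr_sqr ?nnegrE ?rnorm_ge0 ?(ltW d0) //.
  rewrite (rnorm_proj_sub _ onE sE tE st) ltrBlDl; rewrite ltrBlDr in lts.
  by apply: le_lt_trans lts; apply: (sup_upper_bound supX); exists t.
have /choice[s sP] : forall n : nat, exists s, finite_in E s /\ forall t, finite_in E t ->
    {subset s <= t} -> rnorm (proj_seq t h - proj_seq s h) < n.+1%:R^-1.
  move=> n; have [|s sE hs] := near_sup n.+1%:R^-1; first by rewrite invr_gt0.
  by exists s.
have sE n := (sP n).1; have {}sP n := (sP n).2.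
have small (e : R) : 0 < e -> exists N, forall n, (N <= n)%N -> forall t, finite_in E t ->
    {subset s n <= t} -> rnorm (proj_seq t h - proj_seq (s n) h) < e.
  move=> e0; have [N _ hN] := near_infty_natSinv_lt (PosNum e0); exists N => n Nn t tE st.
  exact: lt_trans (sP n t tE st) (hN n Nn).
have cauchy_p : norm_cauchy (@rnorm R H) (fun n => proj_seq (s n) h).
  move=> e e0; have e2 : 0 < e / 2 by rewrite divr_gt0.
  have [N hN] := small _ e2; exists N => m n Nm Nn.
  set t := undup (s m ++ s n); have tE : finite_in E t by exact: finite_in_union.
  have -> : proj_seq (s m) h - proj_seq (s n) h =
      (proj_seq (s m) h - proj_seq t h) + (proj_seq t h - proj_seq (s n) h).
    by rewrite addrA subrK.
  apply: le_lt_trans (ler_rnormD _ _) _; rewrite [e]splitr rdistrC.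
  by apply: ltrD; apply: hN => //; [exact: sub_union_l|exact: sub_union_r].
have [p pl] := hilbert_complete cauchy_p.
have hp : h - p = 0.
  apply: maxE => e Ee; apply: rnorm_eq0; apply/le_anti; rewrite rnorm_ge0 andbT.
  apply/ler_addgt0Pr => d d0; rewrite add0r; have d2 : 0 < d / 2 by rewrite divr_gt0.
  have [N1 h1] := small _ d2; have [N2 h2] := pl _ d2.
  pose n := maxn N1 N2; have e1 : finite_in E [:: e].
    by split => // x; rewrite inE => /eqP ->.
  have ne : rnorm e = 1.
    by apply/eqP; rewrite -sqrp_eq1 ?rnorm_ge0 // -Re_hdot onE // eqxx.
  set t := undup (s n ++ [:: e]); have tE : finite_in E t by exact: finite_in_union.
  have et : e \in t by apply: sub_union_r; rewrite inE.
  have -> : hdot (h - p) e = hdot (proj_seq t h - proj_seq (s n) h) e +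
                             hdot (proj_seq (s n) h - p) e.
    by rewrite -hdotDl addrA subrK !hdotBl (hdot_proj onE tE).
  apply: le_trans (ler_rnormD _ _) _; rewrite [d]splitr.
  apply: lerD; apply: le_trans (CauchySchwarz _ _) _; rewrite ne mulr1 ltW //.
    by apply: h1 => //; [exact: leq_maxl|exact: sub_union_l].
  by apply: h2; exact: leq_maxr.
have [N hN] := pl _ eps0; exists (s N) => //.
have -> : h - proj_seq (s N) h = p - proj_seq (s N) h.
  by congr (_ - _); apply/eqP; rewrite -subr_eq0 hp.
by rewrite rdistrC; exact: hN.
Qed.

Lemma Parseval_sqr h (eps : R) : 0 < eps -> exists2 s, finite_in (@onb R H) s &
  forall t, finite_in (@onb R H) t -> {subset s <= t} ->
  rnorm h ^+ 2 <= coord_sqr t h + eps.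
Proof.
move=> eps0; have onE := onb_orthonormal.
have d0 : 0 < Num.sqrt eps by rewrite sqrtr_gt0.
have [s sE hs] := Parseval h d0; exists s => // t tE st.
apply: le_trans (_ : coord_sqr s h + eps <= _).
  rewrite -lerBlDl -(rnorm_sub_proj onE sE) -[leRHS](sqr_sqrtr (ltW eps0)).
  by rewrite ler_sqr ?nnegrE ?rnorm_ge0 ?sqrtr_ge0 // ltW.
by rewrite lerD2r; exact: (coord_sqr_sub _ onE sE tE st).
Qed.

Lemma Parseval_sum (vs : seq H) (eps : R) : 0 < eps ->
  exists2 s, finite_in (@onb R H) s & forall t, finite_in (@onb R H) t -> {subset s <= t} ->
  \sum_(v <- vs) rnorm v ^+ 2 <= \sum_(v <- vs) coord_sqr t v + eps.
Proof.
elim: vs eps => [|v vs IH] eps eps0.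
  by exists [::] => // t _ _; rewrite !big_nil add0r ltW.
have e2 : 0 < eps / 2 by rewrite divr_gt0.
have [s1 s1E h1] := Parseval_sqr v e2; have [s2 s2E h2] := IH _ e2.
exists (undup (s1 ++ s2)); first exact: finite_in_union.
move=> t tE st; rewrite !big_cons [eps]splitr addrACA; apply: lerD.
  by apply: h1 => // e /(sub_union_l s2) /st.
by apply: h2 => // e /(sub_union_r s1) /st.
Qed.

End Orthonormal.

Section Esum.
Context {R : realType} {T : choiceType}.
Implicit Types (E : set T) (a : T -> R).

Lemma esum_ge_seq E a s : (forall e, 0 <= a e) -> uniq s -> (forall e, e \in s -> E e) ->
  ((\sum_(e <- s) a e)%:E <= \esum_(e in E) (a e)%:E)%E.
Proof.
move=> a0 us sE; apply: esum_ge; exists [set` s]; first by split.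
by rewrite -fsbig_seq // sumEFin.
Qed.

Lemma esum_le_seq E a (c : R) :
  (forall s, uniq s -> (forall e, e \in s -> E e) -> \sum_(e <- s) a e <= c) ->
  (\esum_(e in E) (a e)%:E <= c%:E)%E.
Proof.
move=> h; apply: ge_ereal_sup => _ [F [finF FE] <-].
rewrite fsbig_finite // sumEFin lee_fin; apply: h; first exact: finmap.fset_uniq.
by move=> e; rewrite in_fset_set // inE => /FE.
Qed.

End Esum.

(** * Comparison of traces *)

Section TraceComparison.
Context {R : realType} {H : hilbertType R}.
Implicit Types (S B : H -> H).

(** Deflation: subtracting the rank-one form [|<u, S x>|^2] from [<Su, u>], where
   [<Sx, x> = 1], keeps the form positive by Cauchy-Schwarz and makes it vanish
   at [x]. *)
Lemma finite_rank_minorant S (vs : seq H) : linear S -> positive_op S ->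
  exists hs : seq H,
    (forall u, \sum_(h <- hs) rnorm (hdot u h) ^+ 2 <= Re (hdot (S u) u)) /\
    (forall v, v \in vs -> \sum_(h <- hs) rnorm (hdot v h) ^+ 2 = Re (hdot (S v) v)).
Proof.
elim: vs S => [|v vs IH] S linS posS.
  by exists [::]; split=> [u|u //]; rewrite big_nil Re_ge0.
have [Sv0|Sv] := eqVneq (Re (hdot (S v) v)) 0.
  have [hs [le_hs eq_hs]] := IH S linS posS; exists hs; split=> // u.
  rewrite inE => /predU1P[->|]; last exact: eq_hs.
  by apply/le_anti; rewrite le_hs Sv0 sumr_ge0 // => e _; exact: sqr_ge0.
set q := Re (hdot (S v) v) in Sv.
have q0 : 0 < q by rewrite lt_neqAle eq_sym Sv; exact/Re_ge0/posS.
pose x := (Num.sqrt q)^-1%:C *: v.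
have Sx u : rnorm (hdot u (S x)) ^+ 2 = rnorm (hdot (S u) v) ^+ 2 / q.
  rewrite /x (linZ linS) hdotZr conjcR -(positive_op_sym linS posS) rnormM exprMn.
  rewrite rnorm_nneg ?invr_ge0 ?sqrtr_ge0 // exprVn sqr_sqrtr ?ltW //; exact: mulrC.
pose S1 u := S u - hdot u (S x) *: S x.
have S1E u : Re (hdot (S1 u) u) = Re (hdot (S u) u) - rnorm (hdot u (S x)) ^+ 2.
  by rewrite hdotBl hdotZl ReD ReN (hdotC (S x)) mulJ_rnorm.
have linS1 : linear S1.
  move=> a u w; rewrite /S1 linS hdotDl hdotZl scalerDl scalerBr -scalerA.
  by rewrite opprD addrACA.
have posS1 : positive_op S1.
  move=> u; rewrite /S1 hdotBl hdotZl (hdotC (S x)) mulJ_rnorm (ReE_ge0 (posS u)).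
  rewrite -rmorphB ler0c /= subr_ge0 Sx ler_pdivrMr //.
  exact: (positive_op_form linS posS u v).2.
have [hs [le_hs eq_hs]] := IH S1 linS1 posS1; exists (S x :: hs).
have le_cons u : \sum_(h <- S x :: hs) rnorm (hdot u h) ^+ 2 <= Re (hdot (S u) u).
  by rewrite big_cons -lerBrDl -S1E.
split=> // u; rewrite inE => /predU1P[->|uvs]; last first.
  by rewrite big_cons eq_hs // S1E addrC subrK.
have Svq : rnorm (hdot (S v) v) = q by rewrite (ReE_ge0 (posS v)) rnorm_nneg // ltW.
apply/le_anti; rewrite le_cons big_cons Sx Svq expr2 mulfK // lerDl andTb.
by apply: sumr_ge0 => e _; exact: sqr_ge0.
Qed.

(** The families [f] dominated by [B] replace the images [f_k = c B W e_k] of an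
   orthonormal family under a contraction [W], so that no factorisation has to
   be constructed.  Decomposing [S] into rank-one forms [|<., h>|^2] that are
   exact on the [f_k] moves the sum over [k] onto the vectors [B' h], where it
   can be re-expanded in the basis that defines the trace. *)
Lemma sum_form_le_trace S B B' (n : nat) (f : 'I_n -> H) (c t : R) :
  linear S -> positive_op S -> (forall u v, hdot (B u) v = hdot u (B' v)) ->
  (forall h, \sum_k rnorm (hdot (f k) h) ^+ 2 <= c ^+ 2 * rnorm (B' h) ^+ 2) ->
  (trace (B' \o S \o B) <= t%:E)%E ->
  \sum_k Re (hdot (S (f k)) (f k)) <= c ^+ 2 * t.
Proof.
move=> linS posS adj fB trS.
have [hs [le_hs eq_hs]] := finite_rank_minorant (codom f) linS posS.
have -> : \sum_k Re (hdot (S (f k)) (f k)) =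
          \sum_(h <- hs) \sum_k rnorm (hdot (f k) h) ^+ 2.
  by rewrite exchange_big; apply: eq_bigr => k _; rewrite eq_hs // codom_f.
apply: le_trans (ler_sum _ (fun h _ => fB h)) _.
rewrite -mulr_sumr; apply: ler_wpM2l; first exact: sqr_ge0.
apply/ler_addgt0Pr => e e0.
have [s sE hs_s] := Parseval_sum (map B' hs) e0.
have := hs_s s sE (fun _ => id); rewrite !big_map => /le_trans; apply.
rewrite lerD2r /coord_sqr exchange_big /=.
apply: le_trans (_ : \sum_(b <- s) Re (hdot (S (B b)) (B b)) <= _).
  apply: ler_sum => b _; apply: le_trans (le_hs (B b)).
  by apply: ler_sum => h _; rewrite rnorm_hdotC -adj.
rewrite -lee_fin; apply: le_trans trS.
have [us subE] := sE.
have adj' u v : hdot (B' u) v = hdot u (B v) by rewrite hdotC -adj -hdotC.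
have -> : trace (B' \o S \o B) = (\esum_(b in onb) (Re (hdot (S (B b)) (B b)))%:E)%E.
  by apply: eq_esum => b _; rewrite /= adj'.
by apply: (esum_ge_seq _ us subE) => b; exact/Re_ge0/posS.
Qed.

End TraceComparison.

(** * Bounds for the trace norm *)

Section Nuclear.
Context {R : realType} {H : hilbertType R}.
Implicit Types (X Y S : H -> H) (c : R).

Definition bessel n (e : 'I_n -> H) :=
  forall h, \sum_k rnorm (hdot (e k) h) ^+ 2 <= rnorm h ^+ 2.

(** By trace duality this says that [X] has trace norm at most [c].  Allowing
   Bessel families in both arguments, and not just orthonormal ones, makes the
   notion stable under composition with contractions. *)
Definition nuclear_le X c := forall n (e f : 'I_n -> H), bessel e -> bessel f ->
  rnorm (\sum_k hdot (X (e k)) (f k)) <= c.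

Lemma nuclear_le_ge0 X c : nuclear_le X c -> 0 <= c.
Proof.
move=> h; have b : bessel (fun _ : 'I_0 => 0 : H).
  by move=> u; rewrite big_ord0 sqr_ge0.
by have := h _ _ _ b b; rewrite big_ord0 rnorm0.
Qed.

Lemma nuclear_le_weak X c c' : c <= c' -> nuclear_le X c -> nuclear_le X c'.
Proof. by move=> cc' h n e f be bf; apply: le_trans (h n e f be bf) cc'. Qed.

Lemma nuclear_le0 : nuclear_le (fun=> 0) 0.
Proof. by move=> n e f _ _; rewrite big1 ?rnorm0 // => k _; rewrite hdot0l. Qed.

Lemma nuclear_leD X Y c c' : nuclear_le X c -> nuclear_le Y c' ->
  nuclear_le (fun v => X v + Y v) (c + c').
Proof.
move=> hX hY n e f be bf; under eq_bigr do rewrite hdotDl.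
rewrite big_split /=; apply: le_trans (ler_rnormD _ _) _.
by apply: lerD; [exact: hX|exact: hY].
Qed.

Lemma nuclear_leZ X c (a : R[i]) : nuclear_le X c ->
  nuclear_le (fun v => a *: X v) (rnorm a * c).
Proof.
move=> hX n e f be bf; under eq_bigr do rewrite hdotZl.
by rewrite -mulr_sumr rnormM ler_wpM2l ?rnorm_ge0 //; exact: hX.
Qed.

Lemma nuclear_le_sum I (r : seq I) (P : pred I) (X : I -> H -> H) (c : I -> R) :
  (forall i, P i -> nuclear_le (X i) (c i)) ->
  nuclear_le (fun v => \sum_(i <- r | P i) X i v) (\sum_(i <- r | P i) c i).
Proof.
move=> h; elim: r => [|i r IH].
  rewrite big_nil; move: nuclear_le0; congr (nuclear_le _ 0).
  by apply/funext => v; rewrite big_nil.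
rewrite big_cons; case: ifPn => Pi; last first.
  move: IH; congr (nuclear_le _ _); apply/funext => v.
  by rewrite big_cons (negPf Pi).
move: (nuclear_leD (h i Pi) IH); congr (nuclear_le _ _); apply/funext => v.
by rewrite big_cons Pi.
Qed.

Lemma eq_nuclear_le X Y c : X =1 Y -> nuclear_le X c -> nuclear_le Y c.
Proof. by move=> /funext ->. Qed.

Lemma bessel_bound n (e : 'I_n -> H) k : bessel e -> rnorm (e k) <= 1.
Proof.
move=> be; have := be (e k); rewrite (bigD1 k) //= hdot_rnorm.
rewrite rnorm_nneg ?sqr_ge0 // => h.
have {}h : (rnorm (e k) ^+ 2) ^+ 2 <= rnorm (e k) ^+ 2.
  by apply: le_trans h; rewrite lerDl sumr_ge0 // => i _; exact: sqr_ge0.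
have := rnorm_ge0 (e k); move: (rnorm _) h => x h x0.
rewrite leNgt; apply/negP => x1; move: h; apply/negP; rewrite -ltNge.
by rewrite -[ltLHS]mulr1 [ltRHS]expr2 ltr_pM2l ?exprn_gt0 // ?expr_gt1 // (lt_trans ltr01).
Qed.

Lemma nuclear_le_lim (Xs : nat -> H -> H) X c : (forall N, nuclear_le (Xs N) c) ->
  (forall v, norm_cvg (@rnorm R H) (Xs^~ v) (X v)) -> nuclear_le X c.
Proof.
move=> hXs hlim n e f be bf.
have cvg_sum : norm_cvg (@rnorm R R[i])
    (fun N => \sum_k hdot (Xs N (e k)) (f k)) (\sum_k hdot (X (e k)) (f k)).
  elim: (index_enum 'I_n) => [|k r IH].
    by move=> d d0; exists 0%N => N _; rewrite !big_nil subr0 rnorm0.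
  have := @norm_cvgD _ _ (@rnorm R R[i]) (@ler_rnormD R R[i])
      (fun N => hdot (Xs N (e k)) (f k)) _ (hdot (X (e k)) (f k)) _ _ IH.
  move=> aux d d0; have [|N hN] := aux _ d d0; last first.
    by exists N => m Nm; rewrite !big_cons; exact: hN.
  move=> {}d {}d0; have [N hN] := hlim (e k) d d0; exists N => m Nm.
  rewrite -hdotBl; apply: le_lt_trans (CauchySchwarz _ _) _.
  apply: le_lt_trans (hN m Nm); rewrite ler_piMr ?rnorm_ge0 //; exact: bessel_bound.
apply: (norm_cvg_le (@ler_rnormD R R[i]) (@rdistrC R R[i]) cvg_sum) => N.
exact: hXs.
Qed.

Lemma sum_CauchySchwarz I (r : seq I) (a b : I -> R) :
  (\sum_(i <- r) a i * b i) ^+ 2 <= (\sum_(i <- r) a i ^+ 2) * (\sum_(i <- r) b i ^+ 2).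
Proof.
elim: r => [|i r IH]; first by rewrite !big_nil mulr0 expr0n.
rewrite !big_cons.
have A0 : 0 <= \sum_(j <- r) a j ^+ 2 by apply: sumr_ge0 => j _; exact: sqr_ge0.
have B0 : 0 <= \sum_(j <- r) b j ^+ 2 by apply: sumr_ge0 => j _; exact: sqr_ge0.
move: (\sum_(j <- r) a j * b j) (\sum_(j <- r) _) (\sum_(j <- r) _) (a i) (b i) A0 B0 IH.
move=> s B A x y A0 B0 IH.
have key : 2 * (x * y) * s <= x ^+ 2 * B + y ^+ 2 * A.
  apply: le_trans (ler_norm _) _; rewrite -ler_sqr ?nnegrE ?normr_ge0 //; last first.
    by rewrite addr_ge0 // mulr_ge0 // sqr_ge0.
  rewrite real_normK ?num_real //.
  apply: le_trans (_ : 4 * (x * y) ^+ 2 * (A * B) <= _).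
    have -> : (2 * (x * y) * s) ^+ 2 = 4 * (x * y) ^+ 2 * s ^+ 2 by ring.
    by apply: ler_wpM2l => //; rewrite mulr_ge0 ?sqr_ge0.
  rewrite -subr_ge0.
  have -> : (x ^+ 2 * B + y ^+ 2 * A) ^+ 2 - 4 * (x * y) ^+ 2 * (A * B) =
            (x ^+ 2 * B - y ^+ 2 * A) ^+ 2 by ring.
  exact: sqr_ge0.
have -> : (x * y + s) ^+ 2 = x ^+ 2 * y ^+ 2 + 2 * (x * y) * s + s ^+ 2 by ring.
have -> : (x ^+ 2 + A) * (y ^+ 2 + B) =
          x ^+ 2 * y ^+ 2 + (x ^+ 2 * B + y ^+ 2 * A) + A * B by ring.
by rewrite lerD // lerD.
Qed.

(** The model is [X = (S'^(1/2) B2)^* Z (S^(1/2) B)] with [|Z| <= m], a product of two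
   Hilbert-Schmidt operators and a bounded one; the hypothesis on the matrix
   entries is what remains of it without square roots. *)
Lemma nuclear_le_form X S S' B B' B2 B2' (m t t' : R) : 0 <= m ->
  linear S -> positive_op S -> linear S' -> positive_op S' ->
  (forall u v, hdot (B u) v = hdot u (B' v)) ->
  (forall u v, hdot (B2 u) v = hdot u (B2' v)) ->
  (trace (B' \o S \o B) <= t%:E)%E -> (trace (B2' \o S' \o B2) <= t'%:E)%E ->
  (forall u v, rnorm (hdot (X u) v) ^+ 2 <=
     m ^+ 2 * (Re (hdot (S (B u)) (B u)) * Re (hdot (S' (B2 v)) (B2 v)))) ->
  nuclear_le X (m * Num.sqrt t * Num.sqrt t').
Proof.
move=> m0 linS posS linS' posS' adj adj2 trS trS' hX n e f be bf.
pose a k := Num.sqrt (Re (hdot (S (B (e k))) (B (e k)))).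
pose b k := Num.sqrt (Re (hdot (S' (B2 (f k))) (B2 (f k)))).
have dom (C C' : H -> H) (g : 'I_n -> H) : (forall u v, hdot (C u) v = hdot u (C' v)) ->
    bessel g -> forall h, \sum_k rnorm (hdot (C (g k)) h) ^+ 2 <= 1 ^+ 2 * rnorm (C' h) ^+ 2.
  move=> adjC bg h; rewrite expr1n mul1r; apply: le_trans (bg (C' h)).
  by apply: ler_sum => k _; rewrite adjC.
have ha : \sum_k a k ^+ 2 <= t.
  have := sum_form_le_trace linS posS adj (dom _ _ _ adj be) trS.
  rewrite expr1n mul1r; apply: le_trans; apply: ler_sum => k _.
  by rewrite sqr_sqrtr //; exact/Re_ge0/posS.
have hb : \sum_k b k ^+ 2 <= t'.
  have := sum_form_le_trace linS' posS' adj2 (dom _ _ _ adj2 bf) trS'.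
  rewrite expr1n mul1r; apply: le_trans; apply: ler_sum => k _.
  by rewrite sqr_sqrtr //; exact/Re_ge0/posS'.
have a0 : 0 <= \sum_k a k ^+ 2 by apply: sumr_ge0 => k _; exact: sqr_ge0.
have b0 : 0 <= \sum_k b k ^+ 2 by apply: sumr_ge0 => k _; exact: sqr_ge0.
apply: le_trans (ler_rnorm_sum _ _ _) _.
apply: le_trans (_ : \sum_k m * (a k * b k) <= _).
  apply: ler_sum => k _; rewrite -ler_sqr ?nnegrE ?rnorm_ge0 //; last first.
    by rewrite !mulr_ge0 // sqrtr_ge0.
  apply: le_trans (hX _ _) _; rewrite !exprMn !sqr_sqrtr //.
    exact/Re_ge0/posS'.
  exact/Re_ge0/posS.
rewrite -mulr_sumr -mulrA ler_wpM2l //.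
have t0 := le_trans a0 ha; have t'0 := le_trans b0 hb.
have q0 : 0 <= Num.sqrt t * Num.sqrt t' by rewrite mulr_ge0 ?sqrtr_ge0.
apply: le_trans (ler_norm _) _; rewrite -ler_sqr ?nnegrE ?normr_ge0 ?q0 //.
rewrite real_normK ?num_real // exprMn !sqr_sqrtr //.
by apply: le_trans (sum_CauchySchwarz _ _ _) _; exact: ler_pM.
Qed.

(** Writing [P = |X|], the contraction [X (P + eps)^-1] replaces the partial isometry
   of the polar decomposition: since [X^* X (P + eps)^-1 = P - eps P (P + eps)^-1],
   pairing [X e] with [X (P + eps)^-1 e] gives [<Pe, e>] up to [eps].  The default
   value [0] of [absop] satisfies the bound trivially. *)
Lemma trace_norm_le X c : bounded_op X -> nuclear_le X c -> (trace_norm X <= c%:E)%E.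
Proof.
move=> bX nX; have c0 := nuclear_le_ge0 nX; have [bX' adj] := adjointP bX.
rewrite /trace_norm /absop; case: xgetP => [P _ [bP posP PP]|_]; last first.
  by apply: esum_le_seq => s _ _; rewrite big1 // => e _; rewrite hdot0l.
have /bounded_opP[linP [k k0 bndP]] := bP.
apply: esum_le_seq => s us sE; apply/ler_addgt0Pr => d d0.
pose eps := d / (size s).+1%:R; have eps0 : 0 < eps by rewrite divr_gt0.
pose A v := P v + eps%:C *: v.
have linA : linear A.
  by move=> a u v; rewrite /A linP !scalerDr addrACA !scalerA (mulrC a).
have AE v : hdot (A v) v = hdot (P v) v + (eps * rnorm v ^+ 2)%:C.
  rewrite hdotDl hdotZl hdot_rnorm; congr (_ + _); exact: (esym (rmorphM _ _ _)).
have posA : positive_op A.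
  move=> v; rewrite AE; apply: addr_ge0; first exact: posP.
  by rewrite ler0c mulr_ge0 ?sqr_ge0 // ltW.
have coerA v : eps * rnorm v ^+ 2 <= Re (hdot (A v) v).
  by rewrite AE ReD lerDr; exact/Re_ge0/posP.
have bndA v : rnorm (A v) <= (k + eps) * rnorm v.
  apply: le_trans (ler_rnormD _ _) _; rewrite mulrDl lerD //.
  by rewrite rnormZ rnorm_nneg // ltW.
have /choice[Y AY] : forall v, exists y, A y = v.
  move=> v; have [||y hy] := @lax_milgram R H A (fun w => hdot w v) eps (k + eps) (rnorm v)
    linA posA bndA eps0 coerA.
  - by move=> a u w; rewrite hdotDl hdotZl.
  - by move=> u; rewrite mulrC; exact: CauchySchwarz.
  by exists y; apply: hdotP => w; rewrite hdotC -hy -hdotC.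
have symY u v : hdot (Y u) v = hdot u (Y v).
  by rewrite -{1}(AY v) -(positive_op_sym linA posA) AY.
have XX u v : hdot (X u) (X v) = hdot (P u) (P v).
  rewrite adj (positive_op_sym linP posP); congr (hdot _ _).
  exact: (congr1 (fun T => T v) (esym PP)).
have PY v : P (Y v) = v - eps%:C *: Y v by rewrite -{2}(AY v) addrK.
have contr v : rnorm (X (Y v)) <= rnorm v.
  rewrite -ler_sqr ?nnegrE ?rnorm_ge0 // -Re_hdot XX Re_hdot -{2}(AY v) rnorm_sqrD.
  rewrite -addrA lerDl hdotZr conjcR ReZ addr_ge0 ?sqr_ge0 //.
  rewrite mulr_ge0 // mulr_ge0 ?(ltW eps0) //.
  exact/Re_ge0/posP.
have contr' h : rnorm (Y (adjoint X h)) <= rnorm h.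
  set z := Y _; have [->|z0] := eqVneq (rnorm z) 0; first exact: rnorm_ge0.
  have {}z0 : 0 < rnorm z by rewrite lt_neqAle rnorm_ge0 eq_sym z0.
  rewrite -(ler_pM2l z0) -expr2 -Re_hdot {1}/z symY hdotC -adj -hdotC.
  apply: le_trans (Re_le_rnorm _) _; apply: le_trans (CauchySchwarz _ _) _.
  by rewrite mulrC ler_wpM2r ?rnorm_ge0.
pose e k := tnth (in_tuple s) k; pose f k := X (Y (e k)).
have onE := @onb_orthonormal R H.
have be : bessel e.
  move=> h; apply: le_trans (Bessel onE (conj us sE) h); rewrite /coord_sqr [leRHS]big_tnth.
  by apply: ler_sum => i _; rewrite rnorm_hdotC.
have bf : bessel f.
  move=> h; apply: le_trans (_ : rnorm (Y (adjoint X h)) ^+ 2 <= _).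
    by apply: le_trans (be _); apply: ler_sum => i _; rewrite /f adj symY.
  by rewrite ler_sqr ?nnegrE ?rnorm_ge0.
have step i : Re (hdot (P (e i)) (e i)) <= Re (hdot (X (e i)) (f i)) + eps.
  have ni : rnorm (e i) ^+ 2 = 1.
    have ei : onb (e i) by apply: sE; exact: mem_tnth.
    by rewrite -Re_hdot onE // eqxx.
  have Y0 : 0 <= Re (hdot (e i) (Y (e i))).
    by rewrite -{1}(AY (e i)); exact/Re_ge0/posA.
  rewrite /f XX PY hdotBr hdotZr conjcR ReD ReN ReZ -addrA lerDl addrC subr_ge0.
  rewrite ler_piMr ?(ltW eps0) // (positive_op_sym linP posP) PY hdotBr hdotZr conjcR.
  by rewrite ReD ReN ReZ Re_hdot ni gerBl mulr_ge0 // ltW.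
rewrite big_tnth; apply: le_trans (ler_sum _ (fun i _ => step i)) _.
rewrite big_split /= -Re_sum; apply: lerD.
  by apply: le_trans (Re_le_rnorm _) _; exact: nX.
rewrite sumr_const card_ord -mulr_natr /eps mulrAC ler_pdivrMr ?ltr0n //.
by rewrite ler_pM2l // ler_nat.
Qed.

End Nuclear.

(** * Contractions in a C*-algebra *)

Section CStarNorm.
Context {R : realType} {U : cstarAlgType R}.
Implicit Types (a b m : U).

Lemma star1 : star 1 = 1 :> U.
Proof. by rewrite -[RHS]starK -[in RHS](mulr1 (star 1)) starM starK mulr1. Qed.

Lemma star0 : star 0 = 0 :> U.
Proof. by apply: (addIr (star 0)); rewrite -starD !add0r. Qed.

Lemma starN a : star (- a) = - star a.
Proof. by apply: (addIr (star a)); rewrite -starD !addNr star0. Qed.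

Lemma starB a b : star (a - b) = star a - star b.
Proof. by rewrite starD starN. Qed.

Lemma cnorm0 : cnorm (0 : U) = 0.
Proof. by rewrite -(scale0r (0 : U)) cnormZ rnorm0 mul0r. Qed.

Lemma cnormN a : cnorm (- a) = cnorm a.
Proof. by rewrite -scaleN1r cnormZ rnormN rnorm1 mul1r. Qed.

Lemma cnormC a b : cnorm (a - b) = cnorm (b - a).
Proof. by rewrite -cnormN opprB. Qed.

Lemma cnorm_ge0 a : 0 <= cnorm a.
Proof. by have := cnormD_le a (- a); rewrite subrr cnorm0 cnormN; lra. Qed.

Lemma cnorm_star a : cnorm (star a) = cnorm a.
Proof.
have le b : cnorm b <= cnorm (star b).
  have [->|b0] := eqVneq (cnorm b) 0; first exact: cnorm_ge0.
  have {}b0 : 0 < cnorm b by rewrite lt_neqAle cnorm_ge0 eq_sym b0.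
  by rewrite -(ler_pM2r b0) -expr2 -cnorm_star_mul cnormM_le.
by apply/le_anti; rewrite le andbT -{2}(starK a) le.
Qed.

Lemma cnorm1_le : cnorm (1 : U) <= 1.
Proof.
have := cnorm_star_mul (1 : U); rewrite star1 mulr1 => h.
have [->|b0] := eqVneq (cnorm (1 : U)) 0; first exact: ler01.
have {}b0 : 0 < cnorm (1 : U) by rewrite lt_neqAle cnorm_ge0 eq_sym b0.
by rewrite -(ler_pM2l b0) mulr1 -expr2 -h.
Qed.

(** The square root is [1 - z], where [z] is the fixed point of
   [z |-> (b + z^2) / 2]; with [rho = 1 - sqrt (1 - |b|)] this map preserves the
   ball of radius [rho] and contracts it by the factor [rho]. *)
Lemma exists_sqrt_one_sub b : star b = b -> cnorm b < 1 ->
  exists2 y, star y = y & y * y = 1 - b.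
Proof.
move=> sb nb; pose rho := 1 - Num.sqrt (1 - cnorm b).
have rho0 : 0 <= rho.
  by rewrite subr_ge0 -[leRHS]sqrtr1 ler_sqrt // lerBlDr lerDl cnorm_ge0.
have rho1 : rho < 1 by rewrite ltrBlDr ltrDl sqrtr_gt0 subr_gt0.
have rhoE : cnorm b + rho ^+ 2 = 2 * rho.
  have : (1 - rho) ^+ 2 = 1 - cnorm b.
    by rewrite /rho opprB addrC subrK sqr_sqrtr // subr_ge0 ltW.
  by rewrite sqrrB mul1r expr1n => h; lra.
pose g z := (2^-1)%:C *: (b + z * z).
have half (v : U) : cnorm ((2^-1)%:C *: v) = cnorm v / 2.
  by rewrite cnormZ rnorm_nneg ?invr_ge0 // mulrC.
have g_ball z : cnorm z <= rho -> cnorm (g z) <= rho.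
  move=> zr; rewrite half ler_pdivrMr // mulrC -rhoE.
  apply: le_trans (cnormD_le _ _) _; rewrite lerD2l.
  by apply: le_trans (cnormM_le _ _) _; rewrite expr2 ler_pM ?cnorm_ge0.
have g_contr z w : cnorm z <= rho -> cnorm w <= rho ->
    cnorm (g z - g w) <= rho * cnorm (z - w).
  move=> zr wr; rewrite /g -scalerBr half ler_pdivrMr // -mulrA [_ * 2]mulrC.
  have -> : b + z * z - (b + w * w) = z * (z - w) + (z - w) * w.
    by rewrite opprD addrACA subrr add0r mulrBr mulrBl addrA subrK.
  apply: le_trans (cnormD_le _ _) _.
  rewrite mulrCA mulr_natl mulr2n.
  apply: lerD; apply: le_trans (cnormM_le _ _) _.
    by rewrite ler_wpM2r ?cnorm_ge0.
  by rewrite mulrC ler_wpM2r ?cnorm_ge0.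
pose z n := iter n g 0.
have z_ball n : cnorm (z n) <= rho.
  by elim: n => [|n IH]; [rewrite /z /= cnorm0|exact: g_ball].
have z_star n : star (z n) = z n.
  elim: n => [|n IH]; first exact: star0.
  by rewrite /z /= -/(z n) /g starZ starD starM IH sb conjcR.
have z_step n : cnorm (z n.+1 - z n) <= 1 * rho ^+ n.
  rewrite mul1r; elim: n => [|n IH].
    by rewrite expr0 /z /= subr0; apply: le_trans (ltW rho1); exact: (z_ball 1%N).
  apply: le_trans (g_contr _ _ (z_ball n.+1) (z_ball n)) _.
  by rewrite exprS ler_wpM2l.
have [w zw] := cnorm_complete _ (geometric_cauchy (@cnormD_le R U) cnorm0 cnormC
  ler01 rho0 rho1 z_step).
have w_ball : cnorm w <= rho by exact: (norm_cvg_le (@cnormD_le R U) cnormC zw).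
have uniq_lim := norm_cvg_unique (@cnormD_le R U) cnormC (@cnorm0_eq0 R U) cnorm_ge0.
have gw : g w = w.
  apply: (uniq_lim (fun n => z n.+1)) => e e0; have [N hN] := zw e e0; exists N => n Nn.
    apply: le_lt_trans (g_contr _ _ (z_ball n) w_ball) _.
    by apply: le_lt_trans (hN n Nn); rewrite ler_piMl ?cnorm_ge0 // ltW.
  by apply: hN; exact: leqW.
have sw : star w = w.
  apply: (uniq_lim z) => // e e0; have [N hN] := zw e e0; exists N => n Nn.
  by rewrite -(z_star n) -starB cnorm_star; exact: hN.
exists (1 - w); first by rewrite starB star1 sw.
have w2 : b + w * w = w + w.
  have := congr1 (fun v => 2%:C *: v) gw; rewrite /g scalerA -rmorphM /= divff ?pnatr_eq0 //.
  by rewrite scale1r => ->; rewrite -[w in RHS]scale1r -scalerDl -rmorphD.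
have -> : b = w + w - w * w by rewrite -w2 addrK.
by rewrite mulrBl mul1r mulrBr mulr1 !opprB addrACA -opprD -addrA; congr (1 + _).
Qed.

Lemma exists_contraction_gap m (e : R) : 0 < e ->
  exists y, star y * y = (cnorm m ^+ 2 + e)%:C *: 1 - star m * m.
Proof.
move=> e0; set s := cnorm m ^+ 2 + e.
have s0 : 0 < s by rewrite ltr_wpDl ?sqr_ge0.
have [||y sy y2] := @exists_sqrt_one_sub (s^-1%:C *: (star m * m)).
- by rewrite starZ starM starK conjcR.
- rewrite cnormZ rnorm_nneg ?invr_ge0 ?(ltW s0) // cnorm_star_mul.
  by rewrite mulrC ltr_pdivrMr // mul1r ltrDl.
exists ((Num.sqrt s)%:C *: y); rewrite starZ sy conjcR -scalerAl -scalerAr scalerA y2.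
rewrite -rmorphM /= -expr2 sqr_sqrtr ?ltW // scalerBr scalerA -rmorphM /=.
by rewrite divff ?gt_eqF // scale1r.
Qed.

End CStarNorm.

(** * The dilation form of a completely positive map *)

Section Dilation.
Context {R : realType} {U : cstarAlgType R} {H : hilbertType R}.
Variable phi : U -> H -> H.
Hypothesis phi_ucp : ucp phi.
Implicit Types (a b m : U) (u v : H) (s t : seq (U * H)).

Let bounded_phi a : bounded_op (phi a). Proof. by have [] := phi_ucp. Qed.
Let linear_phi a : linear (phi a). Proof. by have [] := bounded_phi a. Qed.
Let phi1 : phi 1 = idfun. Proof. by have [] := phi_ucp. Qed.

Lemma ucpP (c : R[i]) a b v : phi (c *: a + b) v = c *: phi a v + phi b v.
Proof. by have [_ ->] := phi_ucp. Qed.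

Lemma ucpD a b v : phi (a + b) v = phi a v + phi b v.
Proof. by have := ucpP 1 a b v; rewrite !scale1r. Qed.

Lemma ucp0 v : phi 0 v = 0.
Proof. by apply: (addIr (phi 0 v)); rewrite -ucpD !add0r. Qed.

Lemma ucpZ (c : R[i]) a v : phi (c *: a) v = c *: phi a v.
Proof. by have := ucpP c a 0 v; rewrite ucp0 !addr0. Qed.

Lemma ucpB a b v : phi (a - b) v = phi a v - phi b v.
Proof. by rewrite ucpD -scaleN1r ucpZ scaleN1r. Qed.

Lemma ucp_sum I (r : seq I) (P : pred I) (F : I -> U) v :
  phi (\sum_(i <- r | P i) F i) v = \sum_(i <- r | P i) phi (F i) v.
Proof. exact: (big_morph (phi^~ v) (fun a b => ucpD a b v) (ucp0 v)). Qed.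

(** A list of pairs [(a_k, h_k)] stands for the vector [\sum_k pi(a_k) V h_k] of the
   Stinespring space of [phi = V^* pi V], and this form is its inner product.
   Only positivity of the form is used, so that the space itself need not be
   separated or completed. *)
Definition dform s t : R[i] :=
  \sum_(p <- s) \sum_(q <- t) hdot (phi (star q.1 * p.1) p.2) q.2.

Definition dmul m s : seq (U * H) := [seq (m * p.1, p.2) | p <- s].

Definition dscale (c : R[i]) s : seq (U * H) := [seq (p.1, c *: p.2) | p <- s].

Lemma dform_ge0 s : 0 <= dform s s.
Proof.
case: s => [|p0 s0]; first by rewrite /dform big_nil.
set s := p0 :: s0; have [_ _ _ cp] := phi_ucp.
pose n := (size s0).+1; pose p (k : 'I_n) := tnth (in_tuple s) k.
(* The matrix with first row [a_1, ..., a_n] gives [(mxstar Y *m Y)_ij = a_i^* a_j]. *)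
pose Y : 'M[U]_n := \matrix_(i, j) (if i == ord0 then (p j).1 else 0).
have posX : positive_mx (mxstar Y *m Y) by exists Y.
have := cp n _ posX (fun k => (p k).2); rewrite exchange_big /=.
have -> // : \sum_(j < n) \sum_(i < n) hdot (phi ((mxstar Y *m Y) i j) (p j).2) (p i).2
  = dform s s.
rewrite /dform [RHS]big_tnth; apply: eq_bigr => j _.
rewrite [RHS]big_tnth; apply: eq_bigr => i _.
congr (hdot (phi _ _) _); rewrite mxE (bigD1 ord0) //= !mxE eqxx big1 ?addr0 // => k k0.
by rewrite !mxE (negPf k0) mulr0.
Qed.

Lemma dform_catl s s' t : dform (s ++ s') t = dform s t + dform s' t.
Proof. by rewrite /dform big_cat. Qed.

Lemma dform_catr s t t' : dform s (t ++ t') = dform s t + dform s t'.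
Proof. by rewrite /dform -big_split; apply: eq_bigr => p _; rewrite big_cat. Qed.

Lemma dform_scalel c s t : dform (dscale c s) t = c * dform s t.
Proof.
rewrite /dform big_map mulr_sumr; apply: eq_bigr => p _.
by rewrite mulr_sumr; apply: eq_bigr => q _; rewrite (linZ (linear_phi _)) hdotZl.
Qed.

Lemma dform_scaler c s t : dform s (dscale c t) = c^* * dform s t.
Proof.
rewrite /dform mulr_sumr; apply: eq_bigr => p _.
by rewrite big_map mulr_sumr; apply: eq_bigr => q _; rewrite hdotZr.
Qed.

Lemma dform_CS s t : dform t s = (dform s t)^* /\
  rnorm (dform s t) ^+ 2 <= Re (dform s s) * Re (dform t t).
Proof.
apply: psd_form_scalar => [c||]; [|exact: dform_ge0|exact: dform_ge0].
have := dform_ge0 (s ++ dscale c t).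
rewrite dform_catl !dform_catr !dform_scalel !dform_scaler.
by rewrite !addrA (mulrA c) .
Qed.

(** The gap [(|m|^2 + e) - m^* m] is a square [y^* y], hence contributes a
   nonnegative term to the form. *)
Lemma dform_dmul_le m s :
  Re (dform (dmul m s) (dmul m s)) <= cnorm m ^+ 2 * Re (dform s s).
Proof.
have D0 := Re_ge0 (dform_ge0 s).
suff gap e : 0 < e ->
    Re (dform (dmul m s) (dmul m s)) <= (cnorm m ^+ 2 + e) * Re (dform s s).
  apply/ler_addgt0Pr => d d0.
  have D1 : 0 < Re (dform s s) + 1 by rewrite ltr_wpDl.
  apply: le_trans (gap _ (divr_gt0 d0 D1)) _; rewrite mulrDl lerD2l mulrAC.
  by rewrite ler_pdivrMr // ler_pM2l // lerDl.
move=> e0; have [y yE] := exists_contraction_gap m e0.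
rewrite -subr_ge0 -ReZ -ReN -ReD.
have -> : ((cnorm m ^+ 2 + e)%:C * dform s s - dform (dmul m s) (dmul m s)) =
          dform (dmul y s) (dmul y s); last exact/Re_ge0/dform_ge0.
rewrite /dform !big_map mulr_sumr -sumrB; apply: eq_bigr => p _.
rewrite !big_map mulr_sumr -sumrB; apply: eq_bigr => q _ /=.
have mulE (w : U) : star (w * q.1) * (w * p.1) = star q.1 * (star w * w) * p.1.
  by rewrite starM !mulrA.
rewrite !mulE yE mulrBr mulrBl -scalerAr -scalerAl mulr1 ucpB ucpZ.
by rewrite hdotBl hdotZl.
Qed.

Lemma ucp_adj a u v : hdot (phi a u) v = hdot u (phi (star a) v).
Proof.
have := (dform_CS [:: (1, v)] [:: (a, u)]).1.
rewrite /dform !big_seq1 /= star1 mul1r mulr1 => ->.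
by rewrite -hdotC.
Qed.

Lemma ucp_adjoint a : adjoint (phi a) = phi (star a).
Proof. by apply: adjoint_unique => // u v; exact: ucp_adj. Qed.

Lemma ucp_bound a v : rnorm (phi a v) <= cnorm a * rnorm v.
Proof.
have [->|n0] := eqVneq (rnorm (phi a v)) 0; first by rewrite mulr_ge0 ?cnorm_ge0 ?rnorm_ge0.
have {}n0 : 0 < rnorm (phi a v) by rewrite lt_neqAle rnorm_ge0 eq_sym n0.
have := (dform_CS (dmul a [:: (1, v)]) [:: (1, phi a v)]).2.
have := dform_dmul_le a [:: (1, v)].
rewrite /dform !big_seq1 /= star1 !mulr1 mul1r !phi1 /= !Re_hdot hdot_rnorm.
rewrite rnorm_nneg ?sqr_ge0 // => le1 le2.
have := le_trans le2 (ler_wpM2r (sqr_ge0 _) le1).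
rewrite [leLHS]expr2 ler_pM2r ?exprn_gt0 // -exprMn ler_sqr ?nnegrE ?rnorm_ge0 //.
by rewrite mulr_ge0 ?cnorm_ge0 ?rnorm_ge0.
Qed.

Definition schwarz_defect a v := phi (star a * a) v - phi (star a) (phi a v).

(** The component of [pi(a) V u] orthogonal to the range of [V], which is
   [pi(a) V u - V V^* pi(a) V u]. *)
Definition dilation_rest a u : seq (U * H) := [:: (a, u); (1, - phi a u)].

Lemma dform_rest a u :
  dform (dilation_rest a u) (dilation_rest a u) = hdot (schwarz_defect a u) u.
Proof.
rewrite /dform !big_cons !big_nil /= star1 !mul1r !mulr1 !addr0 phi1 /=.
rewrite !(linN (linear_phi _)) !hdotNr !hdotNl opprK hdotBl addrACA addNr addr0.
by [].
Qed.

Lemma schwarz_defect_ge0 a : positive_op (schwarz_defect a).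
Proof. by move=> v; rewrite -dform_rest dform_ge0. Qed.

Lemma schwarz_defect_bounded a : bounded_op (schwarz_defect a).
Proof. by apply: (@bounded_sub R H _ (phi (star a) \o phi a)) => //; exact: bounded_comp. Qed.

(** The left-hand side pairs [pi(m)] applied to the defect vector of [a] with the
   defect vector of [b^*]. *)
Lemma second_difference_le a b m u v :
  rnorm (hdot (phi (b * m * a) u - phi (b * m) (phi a u) -
               (phi b (phi (m * a) u) - phi b (phi m (phi a u)))) v) ^+ 2 <=
  cnorm m ^+ 2 * (Re (hdot (schwarz_defect a u) u) *
                  Re (hdot (schwarz_defect (star b) v) v)).
Proof.
have := (dform_CS (dmul m (dilation_rest a u)) (dilation_rest (star b) v)).2.
rewrite [X in rnorm X ^+ 2 <= _](_ : _ = hdot (phi (b * m * a) u -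
  phi (b * m) (phi a u) - (phi b (phi (m * a) u) - phi b (phi m (phi a u)))) v).
  move/le_trans; apply; rewrite dform_rest mulrA ler_wpM2r //.
    exact/Re_ge0/schwarz_defect_ge0.
  by rewrite -dform_rest; exact: dform_dmul_le.
rewrite /dform !big_cons !big_nil /= starK star1 !mul1r !mulr1 !addr0 !mulrA.
rewrite !(linN (linear_phi _)) !hdotNr !hdotNl opprK -!ucp_adj !hdotBl.
by rewrite opprB addrACA [in RHS](addrC (hdot (phi b (phi m _)) v)).
Qed.

End Dilation.

Section Representation.
Context {R : realType} {U : cstarAlgType R} {H : hilbertType R}.
Variable pi : U -> H -> H.
Hypothesis pi_rep : representation pi.

(** Complete positivity: the form is [\sum_k |\sum_j pi(Y_kj) h_j|^2]. *)
Lemma representation_ucp : ucp pi.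
Proof.
have [bpi linpi pi1 piM piS] := pi_rep; split => // n X [Y ->] h.
have piD a b v : pi (a + b) v = pi a v + pi b v.
  by have := linpi 1 a b v; rewrite !scale1r.
have pi0 v : pi 0 v = 0 by apply: (addIr (pi 0 v)); rewrite -piD !add0r.
pose g k := \sum_(j < n) pi (Y k j) (h j).
have -> : \sum_(i < n) \sum_(j < n) hdot (pi ((mxstar Y *m Y) i j) (h j)) (h i) =
          \sum_(k < n) hdot (g k) (g k).
  transitivity (\sum_(i < n) \sum_(k < n) hdot (g k) (pi (Y k i) (h i))).
    apply: eq_bigr => i _.
    transitivity (\sum_(j < n) \sum_(k < n) hdot (pi (Y k j) (h j)) (pi (Y k i) (h i))).
      apply: eq_bigr => j _; rewrite mxE.
      rewrite (big_morph (pi^~ (h j)) (fun a b => piD a b _) (pi0 _)) hdot_suml.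
      apply: eq_bigr => k _; rewrite mxE piM piS /=.
      by rewrite hdotC -(adjointP (bpi _)).2 -hdotC.
    by rewrite exchange_big; apply: eq_bigr => k _; rewrite hdot_suml.
  by rewrite exchange_big; apply: eq_bigr => k _; rewrite hdot_sumr.
by apply: sumr_ge0 => k _; rewrite hdot_rnorm ler0c sqr_ge0.
Qed.

End Representation.

(** * Words in the compressed generators *)

Section Telescoping.

(** A triangle of second differences telescopes to a difference of two corners,
   because the first superdiagonal carries the same values as the diagonal. *)
Lemma telescope_triangle (V : zmodType) (F : nat -> nat -> V) (n : nat) :
  (forall i, (i < n)%N -> F i i.+1 = F i.+1 i.+1) ->
  \sum_(i < n) \sum_(j < n | (i < j)%N) (F i j.+1 - F i j - (F i.+1 j.+1 - F i.+1 j)) =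
  F 0%N n - F n n.
Proof.
move=> diag.
have inner (i : 'I_n) : \sum_(j < n | (i < j)%N)
    (F i j.+1 - F i j - (F i.+1 j.+1 - F i.+1 j)) = - (F i.+1 n - F i n).
  rewrite -(big_geq_mkord i.+1 n xpredT
      (fun j => F i j.+1 - F i j - (F i.+1 j.+1 - F i.+1 j))).
  rewrite sumrB !telescope_sumr ?ltn_ord // diag ?ltn_ord // !opprB.
  by rewrite addrA subrK.
rewrite (eq_bigr _ (fun i _ => inner i)) sumrN.
rewrite -(big_mkord xpredT (fun i => F i.+1 n - F i n)).
by rewrite (telescope_sumr (F^~ n)) // opprB.
Qed.

Lemma prod_slice (R : realType) (T : Type) (n : nat) (w : n.-tuple T) (F : T -> R) i j :
  (j <= n)%N ->
  \prod_(a <- drop i (take j w)) F a = \prod_(k < n | (i <= k < j)%N) F (tnth w k).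
Proof.
case: n w => [|n] w jn.
  by rewrite big_ord0 tuple0 /= big_nil.
have x0 := tnth w ord0; under [RHS]eq_bigr do rewrite (tnth_nth x0).
rewrite (big_nth x0) size_drop size_takel ?size_tuple //.
rewrite -(big_mkord (fun k => (i <= k < j)%N) (fun k => F (nth x0 w k))).
rewrite [RHS](eq_bigl (fun k => (true && (i <= k)) && (k < j))%N) //.
rewrite -(big_nat_widen 0 j n.+1 (fun k => true && (i <= k))%N) //.
rewrite -(big_nat_widenl i 0 j xpredT) //.
rewrite [RHS](_ : _ = \prod_(0 + i <= k < j) F (nth x0 w k)) // big_addn.
rewrite !big_nat; apply: eq_bigr => k /= kj.
by rewrite nth_drop nth_take -?ltn_subRL // addnC.
Qed.

Lemma card_pairs (R : pzRingType) (n : nat) :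
  \sum_(i < n) \sum_(j < n | (i < j)%N) (1 : R) = 'C(n, 2)%:R.
Proof.
rewrite (exchange_big_dep xpredT) //= -bin2_sum big_mkord natr_sum.
apply: eq_bigr => j _; rewrite -(big_ord_widen n (fun=> 1 : R)) 1?ltnW //.
by rewrite sumr_const card_ord.
Qed.

End Telescoping.

Section WordExpansion.
Context {R : realType} {U : cstarAlgType R} {H : hilbertType R} {d : nat}.
Variables (x : 'I_d -> U) (phi : U -> H -> H).
Hypothesis phi_ucp : ucp phi.
Implicit Types (a : label d) (w s : seq (label d)).

Local Notation T := (Tlabel x phi).
Local Notation Tw := (Tword x phi).
Local Notation lv := (label_val x).
Local Notation wv := (word_val x).

Lemma label_val_star a : lv (label_star a) = star (lv a).
Proof. by case: a => i [] /=; rewrite /label_val /= ?starK. Qed.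

Lemma word_val_cat w s : wv (w ++ s) = wv w * wv s.
Proof. exact: big_cat. Qed.

Lemma word_val1 a : wv [:: a] = lv a.
Proof. exact: big_seq1. Qed.

Lemma cnorm_word_val w : cnorm (wv w) <= \prod_(a <- w) cnorm (lv a).
Proof.
rewrite /word_val; elim: w => [|a w IH]; first by rewrite !big_nil cnorm1_le.
rewrite !big_cons; apply: le_trans (cnormM_le _ _) _.
by rewrite ler_wpM2l ?cnorm_ge0.
Qed.

Lemma bounded_ucp (u : U) : bounded_op (phi u).
Proof. by have [] := phi_ucp. Qed.

Lemma bounded_Tword w : bounded_op (Tw w).
Proof.
elim: w => [|a w IH] /=; first exact: bounded_id.
by apply: bounded_comp => //; exact: bounded_ucp.
Qed.

Lemma Tword_cat w s v : Tw (w ++ s) v = Tw w (Tw s v).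
Proof. by elim: w => //= a w ->. Qed.

Definition mixed_word w i j v :=
  Tw (take i w) (phi (wv (drop i (take j w))) (Tw (drop j w) v)).

(** With [b] the [i]-th letter, [a] the [j]-th letter and [Q] the complement of the
   range projection of [V], this is [T_pre V^* pi(b) Q pi(m) Q pi(a) V T_suf],
   expanded in terms of [phi]. *)
Definition word_term w i j (b a : label d) v :=
  let m := wv (drop i.+1 (take j w)) in let u := Tw (drop j.+1 w) v in
  Tw (take i w) (phi (lv b * m * lv a) u - phi (lv b * m) (T a u) -
    (T b (phi (m * lv a) u) - T b (phi m (T a u)))).

(** In a dilation [phi = V^* pi V], write the identity between any two letters as
   the range projection of [V] plus its complement.  Sorting the resulting terms
   by the first and the last occurrence of the complement leaves one term for
   each pair [i < j]. *)
Lemma word_expansion n (w : n.-tuple (label d)) v :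
  phi (wv w) v - Tw w v =
  \sum_(i < n) \sum_(j < n | (i < j)%N) word_term w i j (tnth w i) (tnth w j) v.
Proof.
have phi1 : phi 1 = idfun by have [] := phi_ucp.
pose F i j := mixed_word w i j v.
have sw : size w = n by exact: size_tuple.
have dropS x0 i : (i < n)%N -> drop i w = nth x0 w i :: drop i.+1 w.
  by move=> ik; rewrite (drop_nth x0) // sw.
have takeS x0 i : (i < n)%N -> take i.+1 w = rcons (take i w) (nth x0 w i).
  by move=> ik; rewrite (take_nth x0) // sw.
have -> : phi (wv w) v - Tw w v = F 0%N n - F n n.
  rewrite /F /mixed_word take0 drop0 take_oversize ?sw // drop_oversize ?sw //=.
  by rewrite /word_val big_nil phi1.
rewrite -telescope_triangle; last first.
  move=> i ik; have x0 : label d.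
    by case: (n) ik w {F sw dropS takeS} => // k _ w; exact: (tnth w ord0).
  rewrite /F /mixed_word (takeS x0) // -cats1 drop_cat size_takel ?sw ?(ltnW ik) //.
  have -> : drop i.+1 (take i w ++ [:: nth x0 w i]) = [::].
    by rewrite drop_oversize // size_cat size_takel ?sw ?(ltnW ik) // addn1.
  by rewrite ltnn subnn drop0 word_val1 Tword_cat /= /word_val big_nil phi1.
apply: eq_bigr => i _; apply: eq_bigr => j ij; pose x0 := tnth w i.
rewrite !(tnth_nth x0); set b := nth x0 w i; set a := nth x0 w j.
have [ik jk] := (ltn_ord i, ltn_ord j).
have tj : (i < size (take j w))%N by rewrite size_takel ?sw // ltnW.
have dij : drop i (take j w) = b :: drop i.+1 (take j w).
  by rewrite (drop_nth x0) // nth_take.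
have dj k : (k <= j)%N -> drop k (take j.+1 w) = drop k (take j w) ++ [:: a].
  move=> kj; rewrite (takeS x0) // -cats1 drop_cat size_takel ?sw ?(ltnW jk) //.
  move: kj; rewrite leq_eqVlt => /predU1P[->|->] //.
  by rewrite ltnn subnn drop0 drop_oversize // size_takel ?sw // ltnW.
have linp u : linear (phi u) by have [] := bounded_ucp u.
have linTw s : linear (Tw s) by have [] := bounded_Tword s.
rewrite /F /mixed_word /word_term (takeS x0 i ik) !dj ?(ltnW ij) // dij (dropS x0 _ jk) -/a -/b.
rewrite -cats1 !Tword_cat !word_val_cat !word_val1 -cat1s !word_val_cat !word_val1.
by rewrite -/(T a) -/(T b) /= !(linB (linTw _)).
Qed.

End WordExpansion.

(** * Contextual defects *)

Section Defects.
Context {R : realType} {U : cstarAlgType R} {H : hilbertType R} {d : nat}.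
Variables (x : 'I_d -> U) (phi : U -> H -> H) (Rop : H -> H).
Hypotheses (phi_ucp : ucp phi) (posR : positive_op Rop) (hsR : hilbert_schmidt Rop).
Implicit Types (a : label d) (w s : seq (label d)) (B C : H -> H) (h : H).

Local Notation T := (Tlabel x phi).
Local Notation Tw := (Tword x phi).
Local Notation lv := (label_val x).
Local Notation wv := (word_val x).
Local Notation S a := (schwarz_defect phi (lv a)).

Let bounded_R : bounded_op Rop. Proof. by have [] := hsR. Qed.
Let linear_R : linear Rop. Proof. by have [] := bounded_R. Qed.
Let linS a : linear (S a). Proof. by have [] := schwarz_defect_bounded phi_ucp (lv a). Qed.
Let posS a : positive_op (S a). Proof. exact: schwarz_defect_ge0. Qed.
Let bTw w : bounded_op (Tw w). Proof. exact: bounded_Tword. Qed.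
Let bTw' w : bounded_op (adjoint (Tw w)). Proof. exact: (adjointP (bTw w)).1. Qed.

Lemma R_sym u v : hdot (Rop u) v = hdot u (Rop v).
Proof. exact: positive_op_sym. Qed.

Lemma SdefectE a : Sdefect x phi a = S a.
Proof. by rewrite /Sdefect (ucp_adjoint phi_ucp). Qed.

Lemma context_adj C : bounded_op C ->
  forall u v, hdot (C (Rop u)) v = hdot u (Rop (adjoint C v)).
Proof. by move=> bC u v; rewrite (adjointP bC).2 R_sym. Qed.

Definition defect_trace a C := trace (Rop \o adjoint C \o S a \o C \o Rop).

(** Contextual defects are finite because [Rop] is Hilbert-Schmidt. *)
Definition rdefect a C : R := Num.sqrt (fine (defect_trace a C)).

Lemma rdefect_ge0 a C : 0 <= rdefect a C.
Proof. exact: sqrtr_ge0. Qed.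

Lemma defect_traceE a C : bounded_op C -> defect_trace a C = (rdefect a C ^+ 2)%:E.
Proof.
move=> bC; have adj := context_adj bC.
have E : defect_trace a C = (\esum_(e in onb)
    (Re (hdot (S a (C (Rop e))) (C (Rop e))))%:E)%E.
  by apply: eq_esum => e _ /=; rewrite hdotC -adj -hdotC.
have /bounded_opP[_ [k k0 bS]] := schwarz_defect_bounded phi_ucp (lv a).
have /bounded_opP[_ [c c0 bndC]] := bC.
have [_ sumR] := hsR; set sg := esum _ _ in sumR.
have sg0 : (0 <= sg)%E by apply: esum_ge0 => e _; rewrite lee_fin sqr_ge0.
have sgE : sg = (fine sg)%:E by rewrite fineK // ge0_fin_numE.
have fin : (defect_trace a C <= (k * c ^+ 2 * fine sg)%:E)%E.
  rewrite E; apply: esum_le_seq => s us sE.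
  apply: le_trans (_ : \sum_(e <- s) k * c ^+ 2 * rnorm (Rop e) ^+ 2 <= _).
    apply: ler_sum => e _; apply: le_trans (Re_le_rnorm _) _.
    apply: le_trans (CauchySchwarz _ _) _.
    apply: le_trans (ler_wpM2r (rnorm_ge0 _) (bS _)) _.
    have -> : k * c ^+ 2 * rnorm (Rop e) ^+ 2 =
      k * (c * rnorm (Rop e) * (c * rnorm (Rop e))) by ring.
    by rewrite -[leLHS]mulrA ler_wpM2l // ler_pM ?rnorm_ge0 ?bndC.
  rewrite -mulr_sumr ler_wpM2l ?mulr_ge0 ?sqr_ge0 // -lee_fin -sgE.
  by apply: (esum_ge_seq _ us sE) => e; exact: sqr_ge0.
have ge0 : (0 <= defect_trace a C)%E.
  by rewrite E; apply: esum_ge0 => e _; rewrite lee_fin; apply/Re_ge0/posS.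
have finE : defect_trace a C = (fine (defect_trace a C))%:E.
  by rewrite fineK // ge0_fin_numE //; apply: le_lt_trans fin (ltry _).
by rewrite /rdefect sqr_sqrtr // -lee_fin -finE.
Qed.

Lemma edefectE a C : bounded_op C -> edefect x phi Rop a C = (rdefect a C)%:E.
Proof.
move=> bC; rewrite /edefect SdefectE -/(defect_trace a C) defect_traceE //=.
by rewrite sqrtr_sqr ger0_norm ?rdefect_ge0.
Qed.

(** The hypothesis says [C R^2 C^* <= c^2 R^2], that is [A A^* <= c^2 B B^*] for
   [A = C R] and [B = R]; then [A = c B W] for a contraction [W], and the trace of
   [A^* S A] is at most [c^2] times that of [B^* S B]. *)
Lemma rdefect_le a C (c : R) : bounded_op C -> 0 <= c ->
  (forall h, rnorm (Rop (adjoint C h)) <= c * rnorm (Rop h)) ->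
  rdefect a C <= rdefect a idfun * c.
Proof.
move=> bC c0 domC.
rewrite -ler_sqr ?nnegrE ?rdefect_ge0 ?mulr_ge0 ?rdefect_ge0 //.
rewrite exprMn mulrC -lee_fin -defect_traceE //.
have adj := context_adj bC.
have -> : defect_trace a C = (\esum_(e in onb)
    (Re (hdot (S a (C (Rop e))) (C (Rop e))))%:E)%E.
  by apply: eq_esum => e _ /=; rewrite hdotC -adj -hdotC.
apply: esum_le_seq => s us sE; rewrite big_tnth.
have bid := @bounded_id R H.
apply: (@sum_form_le_trace R H (S a) Rop Rop _
  (fun k => C (Rop (tnth (in_tuple s) k)))) => //.
- exact: R_sym.
- move=> h; apply: le_trans (_ : rnorm (Rop (adjoint C h)) ^+ 2 <= _).
    apply: le_trans (Bessel (@onb_orthonormal R H) (conj us sE) _).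
    rewrite /coord_sqr [leRHS]big_tnth; apply: ler_sum => k _.
    by rewrite adj rnorm_hdotC.
  rewrite -exprMn ler_sqr ?nnegrE ?rnorm_ge0 // mulr_ge0 ?rnorm_ge0 //.
by rewrite -defect_traceE // /defect_trace (adjoint_unique bid).
Qed.

Lemma word_term_nuclear w i j b a :
  nuclear_le (fun v => Rop (word_term x phi w i j b a (Rop v)))
    (cnorm (wv (drop i.+1 (take j w))) * rdefect a (Tw (drop j.+1 w)) *
     rdefect (label_star b) (adjoint (Tw (take i w)))).
Proof.
set m := wv _; set C1 := Tw (drop _ _); set C2 := Tw (take i w).
have bC2 : bounded_op (adjoint C2) by exact: (adjointP (bTw _)).1.
have E (r : R) : 0 <= r -> r = Num.sqrt (r ^+ 2) by move=> r0; rewrite sqrtr_sqr ger0_norm.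
rewrite (E (rdefect a C1)) ?rdefect_ge0 // (E (rdefect (label_star b) _)) ?rdefect_ge0 //.
apply: (@nuclear_le_form R H _ (S a) (S (label_star b)) (C1 \o Rop) (Rop \o adjoint C1)
  (adjoint C2 \o Rop) (Rop \o adjoint (adjoint C2))) => //.
- exact: cnorm_ge0.
- by move=> u v /=; rewrite context_adj //; exact: bTw.
- by move=> u v /=; rewrite context_adj.
- by rewrite -defect_traceE //; exact: bTw.
- by rewrite -defect_traceE.
move=> u v; rewrite R_sym /word_term -/C2 (adjointP (bTw _)).2 label_val_star.
exact: second_difference_le.
Qed.

(** The right-hand side of the first inequality, as a real number. *)
Definition word_bound n (w : n.-tuple (label d)) : R :=
  \sum_(i < n) \sum_(j < n | (i < j)%N)
    rdefect (label_star (tnth w i)) (adjoint (Tw (take i w))) *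
    (\prod_(k < n | (i < k < j)%N) cnorm (lv (tnth w k))) *
    rdefect (tnth w j) (Tw (drop j.+1 w)).

Lemma word_nuclear n (w : n.-tuple (label d)) :
  nuclear_le (Rop \o (phi (wv w) \- Tw w)%R \o Rop) (word_bound w).
Proof.
apply: (@eq_nuclear_le _ _ (fun v => \sum_(i < n) \sum_(j < n | (i < j)%N)
    Rop (word_term x phi w i j (tnth w i) (tnth w j) (Rop v)))).
  move=> v /=; rewrite (word_expansion x phi_ucp) (lin_sum linear_R).
  by apply: eq_bigr => i _; rewrite (lin_sum linear_R).
apply: nuclear_le_sum => i _; apply: nuclear_le_sum => j ij.
apply: nuclear_le_weak (word_term_nuclear _ _ _ _ _).
rewrite mulrAC ler_wpM2r ?rdefect_ge0 // mulrC ler_wpM2l ?rdefect_ge0 //.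
apply: le_trans (cnorm_word_val _ _) _.
by rewrite prod_slice // ltnW.
Qed.

Lemma bounded_word_difference w : bounded_op (Rop \o (phi (wv w) \- Tw w)%R \o Rop).
Proof.
apply: bounded_comp => //; apply: bounded_comp => //; apply: bounded_sub => //.
exact: bounded_ucp.
Qed.

Lemma vartheta_fin B : bounded_op B -> (vartheta Rop B < +oo)%E ->
  exists r : R, [/\ 0 <= r, vartheta Rop B = r%:E
    & forall h, rnorm (Rop (adjoint B h)) <= r * rnorm (Rop h)].
Proof.
move=> bB fin; have [bB' adj] := adjointP bB.
pose X := [set c%:E | c in [set c : R | 0 <= c /\
    op_le (B \o Rop \o Rop \o adjoint B) ((c ^+ 2)%:C \*: (Rop \o Rop))]].
have ge0 : (0 <= vartheta Rop B)%E.
  by apply: le_ereal_inf_tmp => _ [c [c0 _] <-]; rewrite lee_fin.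
exists (fine (vartheta Rop B)).
have E : vartheta Rop B = (fine (vartheta Rop B))%:E by rewrite fineK // ge0_fin_numE.
split => // [|h]; first exact: fine_ge0.
have dom c : 0 <= c -> op_le (B \o Rop \o Rop \o adjoint B) ((c ^+ 2)%:C \*: (Rop \o Rop)) ->
    rnorm (Rop (adjoint B h)) <= c * rnorm (Rop h).
  move=> c0 /(_ h) /Re_ge0 /=; rewrite hdotBl hdotZl adj (R_sym (Rop h)).
  rewrite (R_sym (Rop (adjoint B h))) ReD ReN ReZ !Re_hdot -exprMn subr_ge0.
  by rewrite ler_sqr ?nnegrE ?rnorm_ge0 // mulr_ge0 ?rnorm_ge0.
have [h0|h0] := eqVneq (rnorm (Rop h)) 0.
  have [_ [c [c0 hc] _] _] := ereal_inf_lt fin.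
  by have := dom c c0 hc; rewrite h0 !mulr0.
have {}h0 : 0 < rnorm (Rop h) by rewrite lt_neqAle rnorm_ge0 eq_sym h0.
rewrite -ler_pdivrMr // -lee_fin -E; apply: le_ereal_inf_tmp => _ [c [c0 hc] <-].
by rewrite lee_fin ler_pdivrMr //; exact: dom.
Qed.

Lemma vartheta_bound B (K : R) : bounded_op B -> (vartheta Rop B <= K%:E)%E ->
  forall h, rnorm (Rop (adjoint B h)) <= K * rnorm (Rop h).
Proof.
move=> bB leK h; have [|r [_ E hr]] := vartheta_fin bB; first exact: le_lt_trans leK (ltry _).
by apply: le_trans (hr h) _; rewrite ler_wpM2r ?rnorm_ge0 // -lee_fin -E.
Qed.

Lemma Tword_adj_dom (r : label d -> R) w h :
  (forall a, 0 <= r a) ->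
  (forall a h, rnorm (Rop (adjoint (T a) h)) <= r a * rnorm (Rop h)) ->
  rnorm (Rop (adjoint (Tw w) h)) <= (\prod_(a <- w) r a) * rnorm (Rop h).
Proof.
move=> r0 dom; elim: w h => [|a w IH] h.
  by rewrite big_nil mul1r (adjoint_unique (@bounded_id R H)).
rewrite big_cons /= (adjoint_comp (bounded_ucp phi_ucp _) (bTw w)) /=.
apply: le_trans (IH _) _; rewrite [r a * _]mulrC -mulrA.
by rewrite ler_wpM2l ?prodr_ge0 ?dom.
Qed.

Lemma Tword_dom (r : label d -> R) w h :
  (forall a, 0 <= r a) -> (forall a h, rnorm (Rop (T a h)) <= r a * rnorm (Rop h)) ->
  rnorm (Rop (Tw w h)) <= (\prod_(a <- w) r a) * rnorm (Rop h).
Proof.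
move=> r0 dom; elim: w => [|a w IH] /=; first by rewrite big_nil mul1r.
by rewrite big_cons; apply: le_trans (dom _ _) _; rewrite -mulrA ler_wpM2l.
Qed.

Lemma rdefect_suffix (r : label d -> R) a w :
  (forall b, 0 <= r b) ->
  (forall b h, rnorm (Rop (adjoint (T b) h)) <= r b * rnorm (Rop h)) ->
  rdefect a (Tw w) <= rdefect a idfun * \prod_(b <- w) r b.
Proof.
move=> r0 dom; apply: rdefect_le => //; first exact: prodr_ge0.
by move=> h; exact: Tword_adj_dom.
Qed.

Lemma rdefect_prefix (r : label d -> R) a w :
  (forall b, 0 <= r b) -> (forall b h, rnorm (Rop (T b h)) <= r b * rnorm (Rop h)) ->
  rdefect a (adjoint (Tw w)) <= rdefect a idfun * \prod_(b <- w) r b.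
Proof.
move=> r0 dom; apply: rdefect_le => //; first exact: prodr_ge0.
by move=> h; rewrite adjointK //; exact: Tword_dom.
Qed.

Lemma word_trace_norm n (w : n.-tuple (label d)) :
  (trace_norm (Rop \o (phi (wv w) \- Tw w)%R \o Rop) <=
   \sum_(i < n) \sum_(j < n | (i < j)%N)
     edefect x phi Rop (label_star (tnth w i)) (adjoint (Tw (take i w))) *
     (\prod_(k < n | (i < k < j)%N) cnorm (lv (tnth w k)))%:E *
     edefect x phi Rop (tnth w j) (Tw (drop j.+1 w)))%E.
Proof.
apply: le_trans (trace_norm_le (bounded_word_difference _) (word_nuclear w)) _.
rewrite /word_bound -sumEFin le_eqVlt; apply/orP; left; apply/eqP.
apply: eq_bigr => i _; rewrite -sumEFin; apply: eq_bigr => j _.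
by rewrite !edefectE ?EFinM //; exact: bTw'.
Qed.

Lemma edefect_contexts n (w : n.-tuple (label d)) (i j : 'I_n) :
  (forall a, in_MR Rop (T a)) ->
  (edefect x phi Rop (label_star (tnth w i)) (adjoint (Tw (take i w))) <=
   edefect x phi Rop (label_star (tnth w i)) idfun *
     \prod_(k < n | (k < i)%N) vartheta Rop (adjoint (T (tnth w k))))%E /\
  (edefect x phi Rop (tnth w j) (Tw (drop j.+1 w)) <=
   edefect x phi Rop (tnth w j) idfun *
     \prod_(k < n | (j < k)%N) vartheta Rop (T (tnth w k)))%E.
Proof.
move=> MR; have bid := @bounded_id R H.
have bT a : bounded_op (T a) by exact: bounded_ucp.
have bT' a : bounded_op (adjoint (T a)) by exact: (adjointP (bT a)).1.
have /choice[r rP] a : exists r : R, [/\ 0 <= r, vartheta Rop (T a) = r%:E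
    & forall h, rnorm (Rop (adjoint (T a) h)) <= r * rnorm (Rop h)].
  by apply: vartheta_fin => //; have [] := MR a.
have /choice[r' r'P] a : exists r : R, [/\ 0 <= r, vartheta Rop (adjoint (T a)) = r%:E
    & forall h, rnorm (Rop (T a h)) <= r * rnorm (Rop h)].
  have [|s [s0 sE hs]] := vartheta_fin (bT' a); first by have [] := MR a.
  by exists s; split => // h; move: (hs h); rewrite adjointK.
split.
  rewrite (eq_bigr (fun k => (r' (tnth w k))%:E)); last by move=> k _; have [] := r'P (tnth w k).
  rewrite prodEFin (edefectE _ (bTw' _)) edefectE // -EFinM lee_fin.
  have -> : \prod_(k < n | (k < i)%N) r' (tnth w k) = \prod_(a <- take i w) r' a.
    by rewrite -[take i w]drop0 prod_slice // ltnW.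
  by apply: rdefect_prefix => [b|b h]; have [] := r'P b.
rewrite (eq_bigr (fun k => (r (tnth w k))%:E)); last by move=> k _; have [] := rP (tnth w k).
rewrite prodEFin (edefectE _ (bTw _)) edefectE // -EFinM lee_fin.
rewrite (eq_bigl (fun k : 'I_n => (j.+1 <= k < n)%N)); last by move=> k; rewrite ltn_ord andbT.
rewrite -prod_slice // take_oversize ?size_tuple //.
by apply: rdefect_suffix => [b|b h]; have [] := rP b.
Qed.

Definition rdelta : R := \sum_a rdefect a idfun ^+ 2.

Lemma delta_defectE : delta_defect x phi Rop = rdelta%:E.
Proof.
rewrite /delta_defect /rdelta -sumEFin; apply: eq_bigr => a _.
by rewrite edefectE //; exact: bounded_id.
Qed.

Lemma rdelta_ge0 : 0 <= rdelta.
Proof. by apply: sumr_ge0 => a _; exact: sqr_ge0. Qed.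

Lemma rdefect_mul_le a b : rdefect a idfun * rdefect b idfun <= rdelta.
Proof.
have le c : rdefect c idfun ^+ 2 <= rdelta.
  by rewrite /rdelta (bigD1 c) //= lerDl sumr_ge0 // => e _; exact: sqr_ge0.
have := le a; have := le b; have := sqr_ge0 (rdefect a idfun - rdefect b idfun).
by rewrite sqrrB; move: (rdefect _ _) (rdefect _ _) => u v; rewrite -mulr_natl; lra.
Qed.

Section UniformBound.
Variable K : R.
Hypotheses (K1 : 1 <= K) (cnormK : forall a, cnorm (lv a) <= K)
  (domK : forall a h, rnorm (Rop (T a h)) <= K * rnorm (Rop h))
  (domK' : forall a h, rnorm (Rop (adjoint (T a) h)) <= K * rnorm (Rop h)).

Lemma word_bound_le n (w : n.-tuple (label d)) :
  word_bound w <= 'C(n, 2)%:R * K ^+ (n - 2) * rdelta.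
Proof.
have K0 : 0 <= K by exact: le_trans ler01 K1.
have prodK (s : seq (label d)) : \prod_(b <- s) K = K ^+ size s.
  by rewrite big_const_seq count_predT iter_mulr_1.
rewrite -mulrA -card_pairs mulr_suml; apply: ler_sum => i _.
rewrite mulr_suml; apply: ler_sum => j ij; rewrite mul1r.
have hi := rdefect_prefix (label_star (tnth w i)) (take i w) (fun=> K0) domK.
have hj := rdefect_suffix (tnth w j) (drop j.+1 w) (fun=> K0) domK'.
rewrite !prodK in hi hj; rewrite size_takel ?size_tuple ?(ltnW (ltn_ord i)) // in hi.
rewrite size_drop size_tuple in hj.
have hm : \prod_(k < n | (i < k < j)%N) cnorm (lv (tnth w k)) <= K ^+ (j - i.+1).
  rewrite -(prod_slice _ (fun a => cnorm (lv a))) ?(ltnW (ltn_ord j)) //.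
  have -> : (j - i.+1)%N = size (drop i.+1 (take j w)).
    by rewrite size_drop size_takel ?size_tuple ?(ltnW (ltn_ord j)).
  by rewrite -prodK; apply: ler_prod => a _; rewrite cnorm_ge0 cnormK.
have -> : K ^+ (n - 2) = K ^+ i * K ^+ (j - i.+1) * K ^+ (n - j.+1).
  rewrite -!exprD; congr (K ^+ _); have := ltn_ord j; move: ij; clear; lia.
have pm : 0 <= \prod_(k < n | (i < k < j)%N) cnorm (lv (tnth w k)).
  by apply: prodr_ge0 => k _; exact: cnorm_ge0.
apply: le_trans (ler_pM _ _ (ler_pM _ pm hi hm) hj) _; rewrite ?mulr_ge0 ?rdefect_ge0 //.
set p := rdefect _ _; set q := rdefect _ _.
have -> : p * K ^+ i * K ^+ (j - i.+1) * (q * K ^+ (n - j.+1)) =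
  K ^+ i * K ^+ (j - i.+1) * K ^+ (n - j.+1) * (p * q) by ring.
by rewrite ler_wpM2l ?mulr_ge0 ?exprn_ge0 //; exact: rdefect_mul_le.
Qed.

Lemma word_nuclear_le w :
  nuclear_le (Rop \o (phi (wv w) \- Tw w)%R \o Rop)
    ('C(size w, 2)%:R * K ^+ (size w - 2) * rdelta).
Proof.
exact: nuclear_le_weak (word_bound_le (in_tuple w)) (word_nuclear (in_tuple w)).
Qed.

End UniformBound.

End Defects.

(** * Block operators on an orthogonal sum *)

Section BlockOperators.
Context {R : realType} {H K : hilbertType R}.
Variable J : nat -> H -> K.
Hypothesis tensorJ : l2_tensor J.
Implicit Types (i j N : nat) (u v : H) (k : K).

Let linJ i : linear (J i). Proof. by have [] := tensorJ. Qed.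
Let dotJ i j u v : hdot (J i u) (J j v) = (i == j)%:R * hdot u v.
Proof. by have [] := tensorJ. Qed.
Let totalJ k : (forall i u, hdot k (J i u) = 0) -> k = 0.
Proof. by have [_ _] := tensorJ; apply. Qed.

Lemma rnormJ_iso i u : rnorm (J i u) = rnorm u.
Proof.
apply/eqP; rewrite -(eqrXn2 (ltn0Sn 1)) ?rnorm_ge0 //.
by rewrite -!Re_hdot dotJ eqxx mul1r.
Qed.

Lemma exists_component i : exists J' : K -> H, [/\ linear J',
  forall k, rnorm (J' k) <= rnorm k & forall u k, hdot (J i u) k = hdot u (J' k)].
Proof.
have [|J' [linJ' bJ' adj]] := exists_adjoint (ler01 : 0 <= 1 :> R) (linJ i).
  by move=> v; rewrite mul1r rnormJ_iso.
by exists J'; split => // k; rewrite -[leRHS]mul1r.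
Qed.

(** The adjoint of the isometry [J i]. *)
Definition component i : K -> H := projT1 (cid (exists_component i)).

Let componentP i : [/\ linear (component i), forall k, rnorm (component i k) <= rnorm k
  & forall u k, hdot (J i u) k = hdot u (component i k)].
Proof. exact: (projT2 (cid (exists_component i))). Qed.

Lemma componentJ i j v : component i (J j v) = (i == j)%:R *: v.
Proof.
have [_ _ adj] := componentP i; apply: hdotP => w.
by rewrite hdotC -adj dotJ hdotZl conjcM -hdotC conjC_nat.
Qed.

Definition block_part N (B : nat -> nat -> H -> H) k :=
  \sum_(i < N) \sum_(j < N) J i (B i j (component j k)).

Lemma block_partS N B k : block_part N.+1 B k - block_part N B k =
  \sum_(i < N) J i (B i N (component N k)) + \sum_(j < N.+1) J N (B N j (component j k)).
Proof.
rewrite /block_part big_ord_recr /=; under eq_bigr do rewrite big_ord_recr /=.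
by rewrite big_split /= -addrA [X in X - _]addrC addrK.
Qed.

Lemma sum_half_le N : \sum_(i < N) (2 ^- i : R) <= 2.
Proof.
suff -> : \sum_(i < N) (2 ^- i : R) = 2 - 2 * 2 ^- N.
  by rewrite gerBl mulr_ge0 // invr_ge0 exprn_ge0.
elim: N => [|N IH]; first by rewrite big_ord0 expr0 invr1 mulr1 subrr.
rewrite big_ord_recr /= IH exprS; field; exact: expf_neq0.
Qed.

Section Convergence.
Variables (B : nat -> nat -> H -> H) (c : R).
Hypotheses (c0 : 0 <= c) (lB : forall i j, linear (B i j))
  (bndB : forall i j v, rnorm (B i j v) <= c * 2 ^- i * 2 ^- j * rnorm v).

Let term_le i j k :
  rnorm (J i (B i j (component j k))) <= c * rnorm k * (2 ^- i * 2 ^- j).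
Proof.
have [_ bc _] := componentP j; rewrite rnormJ_iso; apply: le_trans (bndB _ _ _) _.
have -> : c * rnorm k * (2 ^- i * 2 ^- j) = c * 2 ^- i * 2 ^- j * rnorm k.
  by rewrite !mulrA (mulrAC c) (mulrAC (c * _)).
by rewrite ler_wpM2l // !mulr_ge0 // invr_ge0 exprn_ge0.
Qed.

Let half_ge0 i : 0 <= 2 ^- i :> R.
Proof. by rewrite invr_ge0 exprn_ge0. Qed.

Let ck_ge0 k : 0 <= c * rnorm k.
Proof. by rewrite mulr_ge0 ?rnorm_ge0. Qed.

Let row_le N i k :
  \sum_(j < N) rnorm (J i (B i j (component j k))) <= 2 * (c * rnorm k) * 2 ^- i.
Proof.
apply: le_trans (ler_sum _ (fun (j : 'I_N) _ => term_le i j k)) _.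
under eq_bigr do rewrite mulrA.
rewrite -mulr_sumr.
apply: (le_trans (ler_wpM2l (mulr_ge0 (ck_ge0 k) (half_ge0 i)) (sum_half_le _))).
by rewrite [leLHS]mulrC [leLHS]mulrA lexx.
Qed.

Let col_le N j k :
  \sum_(i < N) rnorm (J i (B i j (component j k))) <= 2 * (c * rnorm k) * 2 ^- j.
Proof.
apply: le_trans (ler_sum _ (fun (i : 'I_N) _ => term_le i j k)) _.
under eq_bigr do rewrite mulrCA.
rewrite -mulr_suml.
apply: (le_trans (ler_wpM2r (mulr_ge0 (ck_ge0 k) (half_ge0 j)) (sum_half_le _))).
by rewrite [leLHS]mulrA lexx.
Qed.

Let increment_le N k : rnorm (block_part N.+1 B k - block_part N B k) <=
  4 * (c * rnorm k) * 2^-1 ^+ N.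
Proof.
rewrite block_partS; apply: le_trans (ler_rnormD _ _) _.
apply: le_trans (lerD (ler_rnorm_sum _ _ _) (ler_rnorm_sum _ _ _)) _.
apply: le_trans (lerD (col_le N N k) (row_le N.+1 N k)) _.
by rewrite exprVn -!mulrDl -natrD lexx.
Qed.

Let part_le N k : rnorm (block_part N B k) <= 4 * c * rnorm k.
Proof.
apply: le_trans (ler_rnorm_sum _ _ _) _.
apply: le_trans (ler_sum _ (fun (i : 'I_N) _ => ler_rnorm_sum _ _ _)) _.
apply: le_trans (ler_sum _ (fun (i : 'I_N) _ => row_le N i k)) _.
rewrite -mulr_sumr.
apply: (le_trans (ler_wpM2l (mulr_ge0 (ler0n R 2) (ck_ge0 k)) (sum_half_le _))).
by rewrite [leLHS]mulrC !mulrA -natrM lexx.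
Qed.

Let block_part_linear N : linear (block_part N B).
Proof.
move=> a u v; rewrite /block_part scaler_sumr -big_split; apply: eq_bigr => i _ /=.
rewrite scaler_sumr -big_split; apply: eq_bigr => j _ /=.
by have [linC _ _] := componentP j; rewrite linC lB linJ.
Qed.

Let block_part_entry N i j u v : (i < N)%N -> (j < N)%N ->
  hdot (block_part N B (J j v)) (J i u) = hdot (B i j v) u.
Proof.
move=> iN jN; rewrite /block_part hdot_suml (bigD1 (Ordinal iN)) //= [X in _ + X]big1 ?addr0.
  rewrite hdot_suml (bigD1 (Ordinal jN)) //= [X in _ + X]big1 ?addr0.
    by rewrite dotJ componentJ !eqxx scale1r mul1r.
  move=> k kj; rewrite dotJ componentJ (_ : (k == j :> nat) = false); last exact/negbTE.
  by rewrite scale0r (lin0 (lB _ _)) hdot0l mulr0.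
move=> k ki; rewrite hdot_suml big1 // => l _.
by rewrite dotJ (_ : (k == i :> nat) = false) ?mul0r //; exact/negbTE.
Qed.

(** The geometric weights make the partial sums Cauchy in operator norm. *)
Lemma exists_block_op : exists Q : K -> K, [/\ bounded_op Q,
  forall i j u v, hdot (Q (J j v)) (J i u) = hdot (B i j v) u
  & forall k, norm_cvg (@rnorm R K) (fun N => block_part N B k) (Q k)].
Proof.
have uniq_lim := norm_cvg_unique (@ler_rnormD R K) (@rdistrC R K) (@rnorm_eq0 R K)
  (@rnorm_ge0 R K).
have /choice[Q QP] : forall k, exists l,
    norm_cvg (@rnorm R K) (fun N => block_part N B k) l.
  move=> k; apply: hilbert_complete.
  apply: (geometric_cauchy (@ler_rnormD R K) (@rnorm0 R K) (@rdistrC R K)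
    (c := 4 * (c * rnorm k)) (q := 2^-1)) => [|||n].
  - by rewrite mulr_ge0.
  - by rewrite invr_ge0.
  - by rewrite invf_lt1 // ltr1n.
  - exact: increment_le.
exists Q; split => //.
  apply/bounded_opP; split.
    move=> a u v; apply: (uniq_lim (fun N => block_part N B (a *: u + v))) => //.
    have aux : norm_cvg (@rnorm R K) (fun N => a *: block_part N B u) (a *: Q u).
      move=> e e0; have a0 : 0 < rnorm a + 1 by rewrite ltr_wpDl ?rnorm_ge0.
      have [N hN] := QP u _ (divr_gt0 e0 a0); exists N => n Nn.
      rewrite -scalerBr rnormZ.
      apply: le_lt_trans (_ : (rnorm a + 1) * rnorm (block_part n B u - Q u) < _).
        by rewrite ler_wpM2r ?rnorm_ge0 // lerDl.
      by rewrite mulrC -ltr_pdivlMr //; exact: hN.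
    have := norm_cvgD (@ler_rnormD R K) aux (QP v).
    congr (norm_cvg _ _ _); apply/funext => N; exact/esym/block_part_linear.
  exists (4 * c); first by rewrite mulr_ge0.
  move=> k; exact: (norm_cvg_le (@ler_rnormD R K) (@rdistrC R K) (QP k)).
move=> i j u v; apply/eqP; rewrite -subr_eq0; apply/eqP/rnorm_eq0/le_anti.
rewrite rnorm_ge0 andbT; apply/ler_addgt0Pr => e e0; rewrite add0r.
have u0 : 0 < rnorm u + 1 by rewrite ltr_wpDl ?rnorm_ge0.
have [N hN] := QP (J j v) _ (divr_gt0 e0 u0).
pose n := maxn N (maxn i.+1 j.+1).
have [Nn inn jn] : [/\ (N <= n)%N, (i < n)%N & (j < n)%N].
  by rewrite !leq_max !leqnn ?orbT.
rewrite -(block_part_entry u v inn jn) -hdotBl; apply: le_trans (CauchySchwarz _ _) _.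
rewrite rnormJ_iso rdistrC.
apply: le_trans (_ : rnorm (block_part n B (J j v) - Q (J j v)) * (rnorm u + 1) <= _).
  by rewrite ler_wpM2l ?rnorm_ge0 // lerDl.
by rewrite -ler_pdivlMr // ltW // hN.
Qed.

End Convergence.

(** The difference [D] vanishes on the ranges of the [J j]; hence its adjoint takes
   values orthogonal to all of them, and is zero. *)
Lemma block_op_unique (Q Q' : K -> K) : bounded_op Q -> bounded_op Q' ->
  (forall i j u v, hdot (Q (J j v)) (J i u) = hdot (Q' (J j v)) (J i u)) -> Q = Q'.
Proof.
move=> bQ bQ' blocks; have bD := bounded_sub bQ bQ'; have [_ adj] := adjointP bD.
have DJ j v : (Q \- Q') (J j v) = 0.
  by apply: totalJ => i u /=; rewrite hdotBl blocks subrr.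
have D'0 k : adjoint (Q \- Q') k = 0.
  by apply: totalJ => j v; rewrite hdotC -adj DJ hdot0l conjC0.
apply/funext => k; apply/eqP; rewrite -subr_eq0; apply/eqP.
apply: (@hdotP R K) => w; rewrite hdot0l.
by have := adj k w; rewrite D'0 hdot0r.
Qed.

Lemma block_opP B (c : R) : 0 <= c -> (forall i j, linear (B i j)) ->
  (forall i j v, rnorm (B i j v) <= c * 2 ^- i * 2 ^- j * rnorm v) ->
  bounded_op (block_op J B) /\
  forall k, norm_cvg (@rnorm R K) (fun N => block_part N B k) (block_op J B k).
Proof.
move=> c0 lB bndB; have [Q [bQ Qblocks Qlim]] := exists_block_op c0 lB bndB.
rewrite /block_op; case: xgetP => [Q' _ [bQ' Q'blocks]|noQ]; last by case: (noQ Q).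
rewrite (@block_op_unique Q' Q) // => i j u v.
by rewrite Qblocks Q'blocks.
Qed.

(** The adjoint of an isometry maps Bessel families to Bessel families. *)
Lemma nuclear_le_component (X : H -> H) i j (c : R) : nuclear_le X c ->
  nuclear_le (fun k => J i (X (component j k))) c.
Proof.
move=> nX n e f be bf.
have bessel_component l (g : 'I_n -> K) : bessel g -> bessel (fun m => component l (g m)).
  move=> bg h; rewrite -(rnormJ_iso l h); apply: le_trans (bg _).
  have [_ _ adj] := componentP l; apply: ler_sum => m _.
  by rewrite rnorm_hdotC -adj rnorm_hdotC.
have [_ _ adj] := componentP i; under eq_bigr do rewrite adj.
by apply: nX; exact: bessel_component.
Qed.

(** The finite parts of the difference satisfy the duality bound uniformly, and the
   bound passes to their pointwise limit. *)
Lemma block_trace_norm B B' (c : R) (b : nat -> nat -> R) (t : R) : 0 <= c ->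
  (forall i j, linear (B i j)) -> (forall i j, linear (B' i j)) ->
  (forall i j v, rnorm (B i j v) <= c * 2 ^- i * 2 ^- j * rnorm v) ->
  (forall i j v, rnorm (B' i j v) <= c * 2 ^- i * 2 ^- j * rnorm v) ->
  (forall i j, nuclear_le (fun v => B i j v - B' i j v) (b i j)) ->
  (forall N, \sum_(i < N) \sum_(j < N) b i j <= t) ->
  (trace_norm (block_op J B \- block_op J B')%R <= t%:E)%E.
Proof.
move=> c0 lB lB' bndB bndB' nucB sumb.
have [bQ limQ] := block_opP c0 lB bndB; have [bQ' limQ'] := block_opP c0 lB' bndB'.
apply: trace_norm_le; first exact: bounded_sub.
apply: (nuclear_le_lim (Xs := fun N k => block_part N B k - block_part N B' k)) => [N|k].
  apply: nuclear_le_weak (sumb N) _.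
  apply: (eq_nuclear_le (X := fun k => \sum_(i < N) \sum_(j < N)
    J i (B i j (component j k) - B' i j (component j k)))).
    move=> k; rewrite /block_part -sumrB; apply: eq_bigr => i _; rewrite -sumrB.
    by apply: eq_bigr => j _; rewrite (linB (linJ i)).
  apply: nuclear_le_sum => i _; apply: nuclear_le_sum => j _.
  exact: (nuclear_le_component i j (nucB i j)).
move=> e e0; have e2 : 0 < e / 2 by rewrite divr_gt0.
have [N1 h1] := limQ k _ e2; have [N2 h2] := limQ' k _ e2.
exists (maxn N1 N2) => n; rewrite geq_max => /andP[/h1 l1 /h2 l2].
rewrite /= opprD addrACA -opprD; apply: le_lt_trans (ler_rnormD _ _) _.
by rewrite rnormN [e]splitr ltrD.
Qed.

End BlockOperators.

(** * The word encoding *)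

Section Weights.
Context {R : realType} (K : R).
Hypothesis K1 : 1 <= K.
Implicit Types (m n N : nat).

Let K0 : 0 <= K. Proof. exact: le_trans ler01 K1. Qed.

Lemma pow_div_fact_le n : K ^+ n / n`!%:R <= expR K.
Proof.
case: n => [|n]; first by rewrite expr0 fact0 divr1 -expR0 ler_expR.
by apply: le_trans (expR_ge1Dxn n K0); rewrite lerDr.
Qed.

Lemma pow_div_fact_ge0 n : 0 <= K ^+ n / n`!%:R.
Proof. by rewrite divr_ge0 ?exprn_ge0. Qed.

(** The factor of [2^-i 2^-j delta] in the bound for the block [(i, j)] when [p_i] and
   [p_j] have degrees [m] and [n]; the factorials come from the weights [c_i]. *)
Definition pair_weight m n : R :=
  'C(m + n, 2)%:R * K ^+ (m + n - 2) / (m`!%:R * n`!%:R).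

Let quad m : R := 'C(m, 2)%:R * K ^+ (m - 2) / m`!%:R.
Let lin m : R := m%:R * K ^+ (m - 1) / m`!%:R.

Let factn0 n : n`!%:R != 0 :> R.
Proof. by rewrite pnatr_eq0 -lt0n fact_gt0. Qed.

Let quad_ge0 m : 0 <= quad m.
Proof. by rewrite divr_ge0 ?mulr_ge0 ?exprn_ge0. Qed.

Let quad_le m : quad m <= expR K / 2.
Proof.
rewrite /quad; case: m => [|[|m]].
- by rewrite bin_small // !mul0r divr_ge0 ?expR_ge0.
- by rewrite bin_small // !mul0r divr_ge0 ?expR_ge0.
have -> : (m.+2 - 2 = m)%N by rewrite subn2.
have := @bin_fact m.+2 2 isT; rewrite subn2 /= => <-.
have c0 : ('C(m.+2, 2))%:R != 0 :> R by rewrite pnatr_eq0 -lt0n bin_gt0.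
have -> : 'C(m.+2, 2)%:R * K ^+ m / ('C(m.+2, 2) * (2`! * m`!))%:R = K ^+ m / m`!%:R / 2.
  by rewrite !natrM; field; rewrite factn0 c0.
by rewrite ler_pM2r ?invr_gt0 // pow_div_fact_le.
Qed.

Let lin_ge0 m : 0 <= lin m.
Proof. by rewrite divr_ge0 ?mulr_ge0 ?exprn_ge0. Qed.

Let lin_le m : lin m <= expR K.
Proof.
rewrite /lin; case: m => [|m]; first by rewrite !mul0r expR_ge0.
rewrite subn1 /= factS natrM; apply: le_trans (pow_div_fact_le m).
by rewrite invfM mulrACA divff ?pnatr_eq0 // mul1r lexx.
Qed.

(** Of the two letters counted by [C(m + n, 2)], both lie in the first word, both
   in the second, or one in each. *)
Lemma pair_weightE m n : pair_weight m n =
  quad m * (K ^+ n / n`!%:R) + K ^+ m / m`!%:R * quad n + lin m * lin n.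
Proof.
have bin_add : ('C(m + n, 2) = 'C(m, 2) + 'C(n, 2) + m * n)%N.
  elim: n => [|n IH]; first by rewrite addn0 bin0n addn0 muln0 addn0.
  rewrite addnS !binS IH !bin1; lia.
have pow2 k l : 'C(k, 2)%:R * K ^+ (k + l - 2) = 'C(k, 2)%:R * K ^+ (k - 2) * K ^+ l.
  case: k => [|[|k]]; try by rewrite bin_small ?mul0r.
  by rewrite -mulrA -exprD; congr (_ * K ^+ _); lia.
have pow1 : (m * n)%:R * K ^+ (m + n - 2) = m%:R * K ^+ (m - 1) * (n%:R * K ^+ (n - 1)).
  case: (m) => [|k]; first by rewrite mul0n !mul0r.
  case: (n) => [|l]; first by rewrite muln0 !mul0r mulr0.
  rewrite natrM (mulrACA k.+1%:R) -exprD; congr (_ * K ^+ _); lia.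
rewrite /pair_weight /quad /lin bin_add !natrD !mulrDl pow1 pow2 (addnC m) pow2.
by field; rewrite !factn0.
Qed.

Lemma pair_weight0l n : pair_weight 0 n <= expR K / 2.
Proof.
rewrite pair_weightE /lin /quad bin_small // expr0 fact0 !mul0r !add0r addr0 divr1 mul1r.
exact: quad_le.
Qed.

Lemma pair_weight0r m : pair_weight m 0 <= expR K / 2.
Proof.
by have := pair_weight0l m; rewrite /pair_weight addnC [(0)`!%:R * _]mulrC.
Qed.

Lemma pair_weight00 : pair_weight 0 0 = 0.
Proof. by rewrite /pair_weight bin_small // !mul0r. Qed.

Lemma pair_weight_le m n : pair_weight m n <= 2 * expR (2 * K).
Proof.
rewrite pair_weightE; have -> : expR (2 * K) = expR K * expR K.
  by rewrite mulr_natl mulr2n expRD.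
have -> : 2 * (expR K * expR K) =
  expR K / 2 * expR K + expR K * (expR K / 2) + expR K * expR K by field.
by rewrite !lerD // ler_pM // ?pow_div_fact_ge0 ?pow_div_fact_le.
Qed.

(** As the zeroth polynomial has degree 0, the row and the column of index 0 each
   contribute at most [e^K / 2]. *)
Lemma sum_pair_weight (deg : nat -> nat) N : deg 0%N = 0%N ->
  \sum_(i < N) \sum_(j < N) 2 ^- i * 2 ^- j * pair_weight (deg i) (deg j) <=
  expR K + 2 * expR (2 * K).
Proof.
move=> deg0; have rhs0 : 0 <= expR K + 2 * expR (2 * K).
  by rewrite addr_ge0 ?mulr_ge0 ?expR_ge0.
case: N => [|N]; first by rewrite big_ord0.
pose s := \sum_(i < N) (2 ^- i.+1 : R).
have s0 : 0 <= s by apply: sumr_ge0 => i _; rewrite invr_ge0 exprn_ge0.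
have s1 : s <= 1.
  suff -> : s = 1 - 2 ^- N by rewrite gerBl invr_ge0 exprn_ge0.
  rewrite /s; elim: (N) => [|k IH]; first by rewrite big_ord0 expr0 invr1 subrr.
  by rewrite big_ord_recr /= IH exprS; field; exact: expf_neq0.
have h0 i : 0 <= 2 ^- i :> R by rewrite invr_ge0 exprn_ge0.
have first_row : \sum_(j < N.+1) 2 ^- 0 * 2 ^- j * pair_weight (deg 0%N) (deg j) <=
    s * (expR K / 2).
  rewrite big_ord_recl /= deg0 pair_weight00 mulr0 add0r mulr_suml.
  apply: ler_sum => j _; rewrite expr0 invr1 mul1r.
  by rewrite ler_wpM2l // pair_weight0l.
have other_rows i : \sum_(j < N.+1) 2 ^- i.+1 * 2 ^- j * pair_weight (deg i.+1) (deg j) <=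
    2 ^- i.+1 * (expR K / 2 + s * (2 * expR (2 * K))).
  rewrite big_ord_recl /= expr0 invr1 mulr1 mulrDr deg0; apply: lerD.
    by rewrite ler_wpM2l // pair_weight0r.
  rewrite [leRHS]mulrA /s mulr_sumr mulr_suml; apply: ler_sum => j _.
  by apply: ler_wpM2l; [rewrite mulr_ge0|exact: pair_weight_le].
rewrite big_ord_recl /=.
apply: le_trans (lerD first_row (ler_sum _ (fun (i : 'I_N) _ => other_rows i))) _.
rewrite -mulr_suml -/s.
have e0 := expR_ge0 K; have e2 := expR_ge0 (2 * K).
have l1 : s * (expR K / 2) <= expR K / 2 by rewrite ler_piMl // divr_ge0.
have l2 : s * (s * (2 * expR (2 * K))) <= 2 * expR (2 * K).
  by rewrite mulrA ler_piMl ?mulr_ge0 // mulr_ile1.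
rewrite mulrDr; apply: le_trans (lerD l1 (lerD l1 l2)) _.
by rewrite addrA -splitr.
Qed.

End Weights.

Section EncodingBound.
Context {R : realType} {U : cstarAlgType R} {H : hilbertType R} {d : nat}.
Variables (x : 'I_d -> U) (phi piT : U -> H -> H) (Rop : H -> H) (Kb : R).
Variable p : poly_family R d.
Hypotheses (phi_ucp : ucp phi) (posR : positive_op Rop) (hsR : hilbert_schmidt Rop)
  (rep_piT : representation piT) (piT_x : forall i, piT (x i) = phi (x i))
  (Kb1 : 1 <= Kb) (cnormK : forall a, cnorm (label_val x a) <= Kb).
Implicit Types (w s : seq (label d)) (i j : nat) (v : H).

Local Notation Tw := (Tword x phi).
Local Notation wv := (word_val x).

Let K0 : 0 <= Kb. Proof. exact: le_trans ler01 Kb1. Qed.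
Let bounded_R : bounded_op Rop. Proof. by have [] := hsR. Qed.
Let linR : linear Rop. Proof. by have [] := bounded_R. Qed.
Let ucp_piT : ucp piT. Proof. exact: representation_ucp. Qed.

(** The defining property of [pi_T]: on words it is the product of the compressed
   letters, [piT] being multiplicative and equal to [phi] on labels. *)
Lemma piT_word w : piT (wv w) = Tw w.
Proof.
have [_ _ pi1 piM piS] := rep_piT.
have piL a : piT (label_val x a) = phi (label_val x a).
  case: a => i [] /=; rewrite /label_val /= ?piS piT_x //.
  exact: ucp_adjoint.
rewrite /word_val; elim: w => [|a w IH]; first by rewrite big_nil pi1.
by rewrite big_cons piM piL IH.
Qed.

Lemma star_word_val w : star (wv w) = wv (rev (map (@label_star d) w)).
Proof.
elim: w => [|a w IH]; first by rewrite /word_val !big_nil star1.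
rewrite /= rev_cons -cats1 word_val_cat word_val1 label_val_star -IH -starM.
by rewrite /word_val big_cons.
Qed.

Lemma star_sum I (r : seq I) (P : pred I) (F : I -> U) :
  star (\sum_(i <- r | P i) F i) = \sum_(i <- r | P i) star (F i).
Proof. exact: (big_morph _ (@starD R U) star0). Qed.

Lemma pvalM i j : star (pval x p i) * pval x p j =
  \sum_(w : (pdeg p i).-tuple (label d)) \sum_(s : (pdeg p j).-tuple (label d))
    ((pcoef p i w)^* * pcoef p j s) *: wv (rev (map (@label_star d) w) ++ s).
Proof.
rewrite /pval star_sum mulr_suml; apply: eq_bigr => w _.
rewrite mulr_sumr; apply: eq_bigr => s _.
by rewrite starZ -scalerAl -scalerAr scalerA star_word_val word_val_cat.
Qed.

Lemma cnorm_pval i : cnorm (pval x p i) <= pabs p i * Kb ^+ pdeg p i.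
Proof.
have cnorm_sum I (r : seq I) (F : I -> U) :
    cnorm (\sum_(k <- r) F k) <= \sum_(k <- r) cnorm (F k).
  elim/big_rec2: _ => [|k y z _ h]; first by rewrite cnorm0.
  by apply: le_trans (cnormD_le _ _) _; rewrite lerD2l.
apply: le_trans (cnorm_sum _ _ _) _; rewrite /pabs mulr_suml.
apply: ler_sum => w _; rewrite cnormZ ler_wpM2l ?rnorm_ge0 //.
apply: le_trans (cnorm_word_val _ _) _.
apply: le_trans (_ : \prod_(a <- w) Kb <= _).
  by apply: ler_prod => a _; rewrite cnorm_ge0 cnormK.
by rewrite big_const_seq count_predT iter_mulr_1 size_tuple.
Qed.

Lemma pabs_ge0 i : 0 <= pabs p i.
Proof. by apply: sumr_ge0 => w _; exact: rnorm_ge0. Qed.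

Lemma pabs0 : pabs p 0 = 1.
Proof.
rewrite /pabs; move: (pdeg p 0) (pdeg0 p) => n -> {n}.
rewrite (big_pred1 [tuple]) => [|w]; first by rewrite pcoef0 rnorm1.
by apply/esym/eqP; exact: tuple0.
Qed.

Lemma pweight_ge0 i : 0 <= pweight p i.
Proof.
case: i => [|i]; first exact: ler01.
rewrite divr_ge0 ?invr_ge0 ?exprn_ge0 // mulr_ge0 //.
by rewrite le_max ler01.
Qed.

Lemma pweight_pabs i : pweight p i * pabs p i <= 2 ^- i / (pdeg p i)`!%:R.
Proof.
case: i => [|i]; first by rewrite pabs0 mulr1 pdeg0 fact0 expr0 !invr1 mulr1.
have f0 : 0 < (pdeg p i.+1)`!%:R :> R by rewrite ltr0n fact_gt0.
have m0 : 0 < Num.max 1 (pabs p i.+1) by rewrite lt_max ltr01.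
have -> : pweight p i.+1 * pabs p i.+1 =
    2 ^- i.+1 / (pdeg p i.+1)`!%:R * (pabs p i.+1 / Num.max 1 (pabs p i.+1)).
  by rewrite /pweight invfM !mulrA (mulrAC _ _ (pabs p i.+1)).
rewrite ler_piMr ?divr_ge0 ?(ltW f0) ?invr_ge0 ?exprn_ge0 //.
by rewrite ler_pdivrMr // mul1r le_max lexx orbT.
Qed.

Lemma pweight_cnorm i : pweight p i * cnorm (pval x p i) <= 2 ^- i * expR Kb.
Proof.
apply: le_trans (ler_wpM2l (pweight_ge0 i) (cnorm_pval i)) _.
rewrite mulrA; apply: le_trans (ler_wpM2r _ (pweight_pabs i)) _; first exact: exprn_ge0.
rewrite -mulrA ler_wpM2l ?invr_ge0 ?exprn_ge0 // mulrC.
exact: pow_div_fact_le.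
Qed.

Lemma Qblock_linear (psi : U -> H -> H) i j : ucp psi -> linear (Qblock x Rop p psi i j).
Proof.
move=> psi_ucp a u v; rewrite /Qblock /= linR.
have [linp _] := bounded_ucp psi_ucp (star (pval x p i) * pval x p j).
by rewrite linp linR scalerDr !scalerA (mulrC a).
Qed.

Lemma Qblock_bound (psi : U -> H -> H) (r : R) i j v : ucp psi -> 0 <= r ->
  (forall v, rnorm (Rop v) <= r * rnorm v) ->
  rnorm (Qblock x Rop p psi i j v) <= (r * expR Kb) ^+ 2 * 2 ^- i * 2 ^- j * rnorm v.
Proof.
move=> psi_ucp r0 bR; have [wi wj] := (pweight_ge0 i, pweight_ge0 j).
rewrite /Qblock /= rnormZ rnorm_nneg ?mulr_ge0 //.
apply: le_trans (ler_wpM2l (mulr_ge0 wi wj) (bR _)) _.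
have l1 : rnorm (psi (star (pval x p i) * pval x p j) (Rop v)) <=
    cnorm (pval x p i) * cnorm (pval x p j) * (r * rnorm v).
  apply: le_trans (ucp_bound psi_ucp _ _) _; rewrite ler_pM ?cnorm_ge0 ?rnorm_ge0 //.
  by apply: le_trans (cnormM_le _ _) _; rewrite cnorm_star.
apply: le_trans (ler_wpM2l (mulr_ge0 wi wj) (ler_wpM2l r0 l1)) _.
have -> : pweight p i * pweight p j *
    (r * (cnorm (pval x p i) * cnorm (pval x p j) * (r * rnorm v))) =
  (pweight p i * cnorm (pval x p i)) * (pweight p j * cnorm (pval x p j)) *
    (r ^+ 2 * rnorm v) by ring.
have -> : (r * expR Kb) ^+ 2 * 2 ^- i * 2 ^- j * rnorm v =
  (2 ^- i * expR Kb) * (2 ^- j * expR Kb) * (r ^+ 2 * rnorm v).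
  by move: (2 ^- i) (2 ^- j) => a b; ring.
rewrite ler_wpM2r ?mulr_ge0 ?sqr_ge0 ?rnorm_ge0 //.
by rewrite ler_pM ?mulr_ge0 ?cnorm_ge0 ?pweight_cnorm.
Qed.

Hypotheses
  (domK : forall a h, rnorm (Rop (Tlabel x phi a h)) <= Kb * rnorm (Rop h))
  (domK' : forall a h, rnorm (Rop (adjoint (Tlabel x phi a) h)) <= Kb * rnorm (Rop h)).

Local Notation dlt := (rdelta x phi Rop).

Lemma Qblock_nuclear i j :
  nuclear_le (fun v => Qblock x Rop p phi i j v - Qblock x Rop p piT i j v)
    (2 ^- i * 2 ^- j * pair_weight Kb (pdeg p i) (pdeg p j) * dlt).
Proof.
pose n := (pdeg p i + pdeg p j)%N.
pose b := 'C(n, 2)%:R * Kb ^+ (n - 2) * dlt.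
have b0 : 0 <= b by rewrite !mulr_ge0 ?exprn_ge0 // rdelta_ge0.
pose X w v := Rop (phi (wv w) (Rop v) - Tw w (Rop v)).
have nX (w : (pdeg p i).-tuple (label d)) (s : (pdeg p j).-tuple (label d)) :
    nuclear_le (X (rev (map (@label_star d) w) ++ s)) b.
  have := word_nuclear_le phi_ucp posR hsR Kb1 cnormK domK domK'
    (rev (map (@label_star d) w) ++ s).
  by rewrite size_cat size_rev size_map !size_tuple.
have [wi wj] := (pweight_ge0 i, pweight_ge0 j).
apply: (eq_nuclear_le (X := fun v => (pweight p i * pweight p j)%:C *:
  (\sum_(w : (pdeg p i).-tuple (label d)) \sum_(s : (pdeg p j).-tuple (label d))
    ((pcoef p i w)^* * pcoef p j s) *: X (rev (map (@label_star d) w) ++ s) v))).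
  move=> v; rewrite /Qblock /= -scalerBr -(linB linR) pvalM.
  rewrite (ucp_sum phi_ucp) (ucp_sum ucp_piT) -sumrB (lin_sum linR).
  congr (_ *: _); apply: eq_bigr => w _.
  rewrite (ucp_sum phi_ucp) (ucp_sum ucp_piT) -sumrB (lin_sum linR).
  apply: eq_bigr => s _; rewrite (ucpZ phi_ucp) (ucpZ ucp_piT) -scalerBr (linZ linR).
  by rewrite piT_word.
pose coef (w : (pdeg p i).-tuple (label d)) (s : (pdeg p j).-tuple (label d)) :=
  (pcoef p i w)^* * pcoef p j s.
apply: (nuclear_le_weak (c := rnorm (pweight p i * pweight p j)%:C *
    \sum_w \sum_s rnorm (coef w s) * b)); last first.
  apply: nuclear_leZ; apply: nuclear_le_sum => w _; apply: nuclear_le_sum => s _.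
  exact/nuclear_leZ/nX.
rewrite rnorm_nneg ?mulr_ge0 //.
have -> : \sum_w \sum_s rnorm (coef w s) * b = pabs p i * pabs p j * b.
  rewrite /pabs -mulrA mulr_suml; apply: eq_bigr => w _.
  rewrite mulr_suml mulr_sumr; apply: eq_bigr => s _.
  by rewrite rnormM rnormJ mulrA.
have -> : pweight p i * pweight p j * (pabs p i * pabs p j * b) =
  pweight p i * pabs p i * (pweight p j * pabs p j) * b by ring.
have fi : 0 < (pdeg p i)`!%:R :> R by rewrite ltr0n fact_gt0.
have fj : 0 < (pdeg p j)`!%:R :> R by rewrite ltr0n fact_gt0.
apply: le_trans (ler_wpM2r b0 (ler_pM _ _ (pweight_pabs i) (pweight_pabs j))) _.
- by rewrite mulr_ge0 ?pabs_ge0.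
- by rewrite mulr_ge0 ?pabs_ge0.
rewrite le_eqVlt; apply/orP; left; apply/eqP; rewrite /b /pair_weight -/n.
move: (Kb ^+ (n - 2)) => y; field.
by rewrite !expf_neq0 // !gt_eqF.
Qed.

Lemma Qop_trace_norm (K : hilbertType R) (J : nat -> H -> K) : l2_tensor J ->
  (trace_norm (Qop x Rop p J phi \- Qop x Rop p J piT)%R <=
   (expR Kb + 2 * expR (2 * Kb))%:E * delta_defect x phi Rop)%E.
Proof.
move=> tensorJ; rewrite delta_defectE // -EFinM.
have /bounded_opP[_ [r r0 bR]] := bounded_R.
apply: (block_trace_norm tensorJ (sqr_ge0 (r * expR Kb)) (b := fun i j =>
    2 ^- i * 2 ^- j * pair_weight Kb (pdeg p i) (pdeg p j) * dlt)).
- by move=> i j; exact: Qblock_linear.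
- by move=> i j; exact: Qblock_linear.
- by move=> i j v; exact: Qblock_bound.
- by move=> i j v; exact: Qblock_bound.
- exact: Qblock_nuclear.
move=> N; apply: le_trans (ler_wpM2r (rdelta_ge0 x phi Rop)
  (sum_pair_weight Kb1 N (pdeg0 p))).
by rewrite mulr_suml; apply: ler_sum => i _; rewrite mulr_suml.
Qed.

End EncodingBound.

Theorem theorem8p8 (R : realType) (H : hilbertType R) (Rop : H -> H)
    (d : nat) (M : R) (U : cstarAlgType R) (x : 'I_d -> U) (phi : U -> H -> H)
    (Hsep : separable_space H)
    (Rpos : positive_op Rop) (Rinj : injective Rop) (RHS : hilbert_schmidt Rop)
    (Mpos : 0 < M) (HU : universal_cstar M x) (Hphi : ucp phi) :
  let T := Tlabel x phi in
  let e := edefect x phi Rop in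
  let theta := vartheta Rop in
  let delta := delta_defect x phi Rop in
  [/\ forall (n : nat) (w : n.-tuple (label d)), (2 <= n)%N ->
        (trace_norm (Rop \o (phi (word_val x w) \- Tword x phi w)%R \o Rop) <=
         \sum_(i < n) \sum_(j < n | (i < j)%N)
           e (label_star (tnth w i)) (adjoint (Tword x phi (take i w))) *
           (\prod_(k < n | (i < k < j)%N) cnorm (label_val x (tnth w k)))%:E *
           e (tnth w j) (Tword x phi (drop j.+1 w)))%E,
      (forall a, in_MR Rop (T a)) ->
        forall (n : nat) (w : n.-tuple (label d)) (i j : 'I_n), (i < j)%N ->
        (e (label_star (tnth w i)) (adjoint (Tword x phi (take i w))) <=
         e (label_star (tnth w i)) idfun *
           \prod_(k < n | (k < i)%N) theta (adjoint (T (tnth w k))))%E /\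
        (e (tnth w j) (Tword x phi (drop j.+1 w)) <=
         e (tnth w j) idfun * \prod_(k < n | (j < k)%N) theta (T (tnth w k)))%E
    & forall Kb : R, Num.max 1 M <= Kb ->
        (forall a, (Lambda Rop (T a) <= Kb%:E)%E) ->
        (forall (n : nat) (w : n.-tuple (label d)), (2 <= n)%N ->
           (trace_norm (Rop \o (phi (word_val x w) \- Tword x phi w)%R \o Rop) <=
            ('C(n, 2)%:R * Kb ^+ (n - 2))%:E * delta)%E) /\
        forall (p : poly_family R d) (K : hilbertType R) (J : nat -> H -> K)
               (piT : U -> H -> H),
          l2_tensor J -> representation piT ->
          (forall i, piT (x i) = phi (x i)) ->
          (trace_norm (Qop x Rop p J phi \- Qop x Rop p J piT)%R <=
           (expR Kb + 2 * expR (2 * Kb))%:E * delta)%E].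
Proof.
move=> T e theta delta.
have bT a : bounded_op (T a) by exact: bounded_ucp.
split.
- by move=> n w _; exact: word_trace_norm.
- by move=> MR n w i j _; exact: edefect_contexts.
move=> Kb; rewrite ge_max => /andP[Kb1 KbM] LK.
have bT' a : bounded_op (adjoint (T a)) by exact: (adjointP (bT a)).1.
have [thK thK'] : (forall a, (vartheta Rop (T a) <= Kb%:E)%E) /\
    (forall a, (vartheta Rop (adjoint (T a)) <= Kb%:E)%E).
  by split=> a; have := LK a; rewrite /Lambda !ge_max => /and3P[].
have domK' a := vartheta_bound Rpos RHS (bT a) (thK a).
have domK a h : rnorm (Rop (T a h)) <= Kb * rnorm (Rop h).
  by have := vartheta_bound Rpos RHS (bT' a) (thK' a) h; rewrite adjointK.
have cnormK a : cnorm (label_val x a) <= Kb.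
  apply: le_trans KbM; have [xM _] := HU.
  by rewrite /label_val; case: ifP => _; rewrite ?cnorm_star.
split=> [n w _|p K J piT tensorJ rep piTx]; last exact: Qop_trace_norm.
apply: le_trans (trace_norm_le (bounded_word_difference x Hphi RHS w)
  (word_nuclear x Hphi Rpos RHS w)) _.
rewrite /delta delta_defectE // -EFinM lee_fin.
exact: word_bound_le.
Qed.
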